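(* Let $R$ be a commutative noetherian ring and let $S/R$ be relative Frobenius of rank $4$. Choose an $R$-basis $(x,y,z,w)$ of $S$ and let $a_1,\dots,a_m$ be the associated finite list $H$ of words in the letters $x,y,z,w,e,f$, with evaluation map $\chi:R\langle x,y,z,w,e,f\rangle\to\Pi_R(S)$ (both described in the context). Then the map $$\sigma_{R,S}:R[Z_4(R,S)]^{\oplus m}\longrightarrow\Pi_R(S),\qquad (z_i)_{i=1}^m\mapsto\sum_{i=1}^mz_i\,\chi(a_i)$$ is surjective.
   Context: Relative Frobenius pairs: let $R\to S$ be a morphism of commutative rings. $S/R$ is relative Frobenius of rank $n$ if $S$ is a free $R$-module of rank $n$ and $\operatorname{Hom}_R(S,R)\cong S$ as $S$-modules. Generalized preprojective algebra: given such a pair, let $R\oplus S$ be the product ring. Let $M={}_RS_S$, viewed as an $R\oplus S$-bimodule with $R$ acting on the left, $S$ acting on the right and the other components acting by zero. Let $N={}_SS_R$, viewed as an $R\oplus S$-bimodule with $S$ acting on the left, $R$ acting on the right and the other components acting by zero. Put $T(R,S)=T_{R\oplus S}(M\oplus N)$ (tensor algebra over $R\oplus S$, graded by tensor degree). Then $M\otimes_{R\oplus S}M=N\otimes_{R\oplus S}N=0$, $M\otimes_{R\oplus S}N=S\otimes_SS$ (an $R$-$R$-bimodule) and $N\otimes_{R\oplus S}M=S\otimes_RS$ (an $S$-$S$-bimodule). Let $\lambda$ be a generator of $\operatorname{Hom}_R(S,R)$ as an $S$-module and let $(e_i)_i,(f_j)_j$ be $R$-bases of $S$ with $\lambda(e_if_j)=\delta_{ij}$.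 Then $\Pi_R(S)=T(R,S)/I$, where $I$ is the two-sided ideal generated by the degree $2$ elements $1\otimes 1\in M\otimes_{R\oplus S}N$ and $\sum_ie_i\otimes f_i\in N\otimes_{R\oplus S}M$. It is an $\mathbb{N}$-graded $R$-algebra (via $r\mapsto(r,r\cdot1_S)\in R\oplus S$), independent of the choices up to isomorphism. $Z_4(R,S)$ denotes the degree $4$ part of the center of $\Pi_R(S)$, and $R[Z_4(R,S)]$ is the $R$-subalgebra of the center generated by it. The map $\chi$: it is the $R$-algebra morphism from the free algebra $R\langle x,y,z,w,e,f\rangle$ to $\Pi_R(S)$ sending $x,y,z,w$ to the corresponding basis elements of $S\subset R\oplus S=\Pi_R(S)_0$, sending $e$ to the class of $1_S\in N$ and sending $f$ to the class of $1_S\in M$. The list $H=\{a_1,\dots,a_m\}$: it is the finite set (in some chosen order) of all words (including the empty word) in the letters $x,y,z,w,e,f$ that contain at most $6$ letters from $\{e,f\}$ counted with multiplicity, in which no letter $e$ is immediately followed by $e$, no letter $f$ is immediately followed by $f$, and any two occurrences of letters from $\{x,y,z,w\}$ are separated by at least one letter $e$ or $f$. (Words containing $ee$ or $ff$ have image $0$ under $\chi$.) *)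

(* Defs.v *)
From HB Require Import structures.
From mathcomp Require Import all_boot all_algebra.
From mathcomp Require Import boolp zify.

Set Implicit Arguments.
Unset Strict Implicit.
Unset Printing Implicit Defensive.

Import GRing.Theory.
Local Open Scope ring_scope.
Local Open Scope quotient_scope.

(* Rings are [pzRingType]s, so that the zero ring is allowed. *)

Definition two_sided_ideal (U : pzRingType) (J : U -> Prop) : Prop :=
  [/\ J 0, forall x y, J x -> J y -> J (x - y),
      forall u x, J x -> J (u * x) & forall u x, J x -> J (x * u)].

Definition ideal_gen (U : pzRingType) (X : U -> Prop) (u : U) : Prop :=
  forall J, two_sided_ideal J -> (forall x, X x -> J x) -> J u.

Lemma ideal_genP (U : pzRingType) (X : U -> Prop) :
  two_sided_ideal (ideal_gen X).
Proof.
split.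
- by move=> J [].
- by move=> x y Hx Hy J HJ HX; case: (HJ) => _ HB _ _; apply: HB; [apply: Hx|apply: Hy].
- by move=> u x Hx J HJ HX; case: (HJ) => _ _ HM _; apply: HM; apply: Hx.
- by move=> u x Hx J HJ HX; case: (HJ) => _ _ _ HM; apply: HM; apply: Hx.
Qed.

Lemma ideal_gen_mem (U : pzRingType) (X : U -> Prop) (x : U) :
  X x -> ideal_gen X x.
Proof. by move=> Xx J _; apply. Qed.

Section IdealQuotient.

Variables (U : pzRingType) (X : U -> Prop).

Let J := ideal_gen X.

Definition ideal_equiv (x y : U) : bool := `[< J (x - y) >].

Lemma ideal_equiv_is_equiv : equiv_class_of ideal_equiv.
Proof.
have [J0 JB _ _] := ideal_genP X.
have JN x : J x -> J (- x) by move=> Jx; rewrite -sub0r; apply: JB.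
split=> [x|x y|y x z]; rewrite /ideal_equiv.
- by apply/asboolP; rewrite subrr.
- by apply/asboolP/asboolP => /JN; rewrite opprB.
- move=> /asboolP Jxy /asboolP Jyz; apply/asboolP.
  by have := JB _ _ Jxy (JN _ Jyz); rewrite opprK addrA subrK.
Qed.

Canonical ideal_equiv_equiv := EquivRelPack ideal_equiv_is_equiv.
Canonical ideal_equiv_encModRel := defaultEncModRel ideal_equiv.

Definition ring_quot : Type := {eq_quot ideal_equiv}.

HB.instance Definition _ := Choice.on ring_quot.
HB.instance Definition _ : EqQuotient U ideal_equiv ring_quot :=
  EqQuotient.on ring_quot.

Definition quot_proj (x : U) : ring_quot := \pi_ring_quot x.

Lemma quot_projP x y : quot_proj x = quot_proj y <-> J (x - y).
Proof.
rewrite /quot_proj; split=> [/eqP|H].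
  by rewrite (@eqquotE _ _ ring_quot) => /asboolP.
by apply/eqP; rewrite (@eqquotE _ _ ring_quot); apply/asboolP.
Qed.

Lemma quot_proj_surj (q : ring_quot) : exists x, quot_proj x = q.
Proof. by exists (repr q); apply: reprK. Qed.

Let rq (q : ring_quot) : U := repr q.
Let rqK q : quot_proj (rq q) = q. Proof. exact: reprK. Qed.
Let Jr x : J (rq (quot_proj x) - x).
Proof. by apply/quot_projP; rewrite rqK. Qed.

Definition quot_opp q := quot_proj (- rq q).
Definition quot_add p q := quot_proj (rq p + rq q).
Definition quot_mul p q := quot_proj (rq p * rq q).

Let JD x y : J x -> J y -> J (x + y).
Proof.
have [J0 JB _ _] := ideal_genP X.
by move=> Jx Jy; rewrite -[y]opprK; apply: (JB) => //; rewrite -sub0r; apply: JB.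
Qed.

Lemma quot_oppE x : quot_opp (quot_proj x) = quot_proj (- x).
Proof.
have [J0 JB _ _] := ideal_genP X.
apply/quot_projP; by rewrite -opprD -sub0r; apply: JB => //; apply: Jr.
Qed.

Lemma quot_addE x y :
  quot_add (quot_proj x) (quot_proj y) = quot_proj (x + y).
Proof. by apply/quot_projP; rewrite opprD addrACA; apply: JD. Qed.

Lemma quot_mulE x y :
  quot_mul (quot_proj x) (quot_proj y) = quot_proj (x * y).
Proof.
have [_ _ JMl JMr] := ideal_genP X.
apply/quot_projP.
set x' := rq _; set y' := rq _.
have -> : x' * y' - x * y = (x' - x) * y' + x * (y' - y).
  by rewrite mulrBl mulrBr addrA subrK.
by apply: JD; [apply: JMr; apply: Jr|apply: JMl; apply: Jr].
Qed.

Fact quot_addA : associative quot_add.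
Proof.
by move=> p q r; rewrite -[p]rqK -[q]rqK -[r]rqK !quot_addE addrA.
Qed.
Fact quot_addC : commutative quot_add.
Proof. by move=> p q; rewrite -[p]rqK -[q]rqK !quot_addE addrC. Qed.
Fact quot_add0 : left_id (quot_proj 0) quot_add.
Proof. by move=> p; rewrite -[p]rqK quot_addE add0r. Qed.
Fact quot_addN : left_inverse (quot_proj 0) quot_opp quot_add.
Proof. by move=> p; rewrite -[p]rqK quot_oppE quot_addE addNr. Qed.

HB.instance Definition _ :=
  GRing.isZmodule.Build ring_quot quot_addA quot_addC quot_add0 quot_addN.

Fact quot_mulA : associative quot_mul.
Proof.
by move=> p q r; rewrite -[p]rqK -[q]rqK -[r]rqK !quot_mulE mulrA.
Qed.
Fact quot_mul1l : left_id (quot_proj 1) quot_mul.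
Proof. by move=> p; rewrite -[p]rqK quot_mulE mul1r. Qed.
Fact quot_mul1r : right_id (quot_proj 1) quot_mul.
Proof. by move=> p; rewrite -[p]rqK quot_mulE mulr1. Qed.
Fact quot_mulDl : left_distributive quot_mul +%R.
Proof.
move=> p q r; rewrite -[p]rqK -[q]rqK -[r]rqK.
by rewrite -![_ + _]/(quot_add _ _) !(quot_addE, quot_mulE) mulrDl.
Qed.
Fact quot_mulDr : right_distributive quot_mul +%R.
Proof.
move=> p q r; rewrite -[p]rqK -[q]rqK -[r]rqK.
by rewrite -![_ + _]/(quot_add _ _) !(quot_addE, quot_mulE) mulrDr.
Qed.

HB.instance Definition _ := GRing.Zmodule_isPzRing.Build ring_quot
  quot_mulA quot_mul1l quot_mul1r quot_mulDl quot_mulDr.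

Fact quot_proj_is_zmod_morphism : zmod_morphism quot_proj.
Proof.
by move=> x y; rewrite -[RHS]/(quot_add _ (quot_opp _)) quot_oppE quot_addE.
Qed.
Fact quot_proj_is_monoid_morphism : monoid_morphism quot_proj.
Proof.
by split=> // x y; rewrite -[RHS]/(quot_mul _ _) quot_mulE.
Qed.

HB.instance Definition _ :=
  GRing.isZmodMorphism.Build U ring_quot quot_proj quot_proj_is_zmod_morphism.
HB.instance Definition _ := GRing.isMonoidMorphism.Build U ring_quot quot_proj
  quot_proj_is_monoid_morphism.

End IdealQuotient.

Record bimodule_axioms (A : pzRingType) (B : zmodType)
    (l : A -> B -> B) (r : B -> A -> B) : Prop := BimoduleAxioms {
  lactDl : forall a a' b, l (a + a') b = l a b + l a' b;
  lactDr : forall a b b', l a (b + b') = l a b + l a b';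
  lactA : forall a a' b, l (a * a') b = l a (l a' b);
  lact1 : forall b, l 1 b = b;
  ractDl : forall b b' a, r (b + b') a = r b a + r b' a;
  ractDr : forall b a a', r b (a + a') = r b a + r b a';
  ractA : forall b a a', r b (a * a') = r (r b a) a';
  ract1 : forall b, r b 1 = b;
  lractA : forall a b a', r (l a b) a' = l a (r b a')
}.

Record bimodule (A : pzRingType) : Type := Bimodule {
  bimod_sort :> zmodType;
  lact : A -> bimod_sort -> bimod_sort;
  ract : bimod_sort -> A -> bimod_sort;
  bimoduleP : bimodule_axioms lact ract
}.

Section BimoduleSum.

Variables (A : pzRingType) (M N : bimodule A).

Definition sum_lact (a : A) (u : M * N) : M * N := (lact a u.1, lact a u.2).
Definition sum_ract (u : M * N) (a : A) : M * N := (ract u.1 a, ract u.2 a).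

Lemma bimod_sumP : bimodule_axioms sum_lact sum_ract.
Proof.
have [? ? ? M1 ? ? ? M1' ?] := bimoduleP M.
have [? ? ? N1 ? ? ? N1' ?] := bimoduleP N.
split; rewrite /sum_lact /sum_ract /=.
- by move=> a a' b; congr (_, _).
- by move=> a b b'; congr (_, _).
- by move=> a a' b; congr (_, _).
- by case=> x y /=; rewrite M1 N1.
- by move=> b b' a; congr (_, _).
- by move=> b a a'; congr (_, _).
- by move=> b a a'; congr (_, _).
- by case=> x y /=; rewrite M1' N1'.
- by move=> a b a'; congr (_, _).
Qed.

Definition bimod_sum : bimodule A := Bimodule bimod_sumP.

End BimoduleSum.

(* T_A(B) is built from generators and relations: formal sums and products of
   elements of A and B, modulo the ring axioms, the relations making
   A -> T_A(B) a ring morphism, and those making B -> T_A(B) a morphism of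
   A-bimodules.  [tensor_alg_universal] is the usual universal property. *)

Section TensorAlgebra.

Variables (A : pzRingType) (B : bimodule A).

Inductive tensor_term : Type :=
| TScal of A
| TVec of B
| TOpp of tensor_term
| TAdd of tensor_term & tensor_term
| TMul of tensor_term & tensor_term.

HB.instance Definition _ := gen_eqMixin tensor_term.
HB.instance Definition _ := gen_choiceMixin tensor_term.

Inductive teq : tensor_term -> tensor_term -> Prop :=
| teq_refl t : teq t t
| teq_sym t u : teq t u -> teq u t
| teq_trans t u v : teq t u -> teq u v -> teq t v
| teq_congrN t t' : teq t t' -> teq (TOpp t) (TOpp t')
| teq_congrD t t' u u' : teq t t' -> teq u u' -> teq (TAdd t u) (TAdd t' u')
| teq_congrM t t' u u' : teq t t' -> teq u u' -> teq (TMul t u) (TMul t' u')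
| teq_addA t u v : teq (TAdd t (TAdd u v)) (TAdd (TAdd t u) v)
| teq_addC t u : teq (TAdd t u) (TAdd u t)
| teq_add0 t : teq (TAdd (TScal 0) t) t
| teq_addN t : teq (TAdd (TOpp t) t) (TScal 0)
| teq_mulA t u v : teq (TMul t (TMul u v)) (TMul (TMul t u) v)
| teq_mul1l t : teq (TMul (TScal 1) t) t
| teq_mul1r t : teq (TMul t (TScal 1)) t
| teq_mulDl t u v : teq (TMul (TAdd t u) v) (TAdd (TMul t v) (TMul u v))
| teq_mulDr t u v : teq (TMul t (TAdd u v)) (TAdd (TMul t u) (TMul t v))
| teq_scalD a a' : teq (TScal (a + a')) (TAdd (TScal a) (TScal a'))
| teq_scalM a a' : teq (TScal (a * a')) (TMul (TScal a) (TScal a'))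
| teq_vecD b b' : teq (TVec (b + b')) (TAdd (TVec b) (TVec b'))
| teq_lact a b : teq (TVec (lact a b)) (TMul (TScal a) (TVec b))
| teq_ract b a : teq (TVec (ract b a)) (TMul (TVec b) (TScal a)).

Definition teqb (t u : tensor_term) : bool := `[< teq t u >].

Lemma teqb_is_equiv : equiv_class_of teqb.
Proof.
split=> [t|t u|u t v]; rewrite /teqb.
- exact/asboolP/teq_refl.
- by apply/asboolP/asboolP => /teq_sym.
- move=> /asboolP tu /asboolP uv; apply/asboolP; exact: teq_trans tu uv.
Qed.

Canonical teqb_equiv := EquivRelPack teqb_is_equiv.
Canonical teqb_encModRel := defaultEncModRel teqb.

Definition tensor_alg : Type := {eq_quot teqb}.

HB.instance Definition _ := Choice.on tensor_alg.
HB.instance Definition _ : EqQuotient tensor_term teqb tensor_alg :=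
  EqQuotient.on tensor_alg.

Definition tclass (t : tensor_term) : tensor_alg := \pi_tensor_alg t.

Lemma tclassP t u : tclass t = tclass u <-> teq t u.
Proof.
rewrite /tclass; split=> [/eqP|H].
  by rewrite (@eqquotE _ _ tensor_alg) => /asboolP.
by apply/eqP; rewrite (@eqquotE _ _ tensor_alg); apply/asboolP.
Qed.

Let trepr (x : tensor_alg) : tensor_term := repr x.
Let treprK x : tclass (trepr x) = x. Proof. exact: reprK. Qed.
Let teq_repr t : teq (trepr (tclass t)) t.
Proof. by apply/tclassP; rewrite treprK. Qed.

Definition tensor_opp x := tclass (TOpp (trepr x)).
Definition tensor_add x y := tclass (TAdd (trepr x) (trepr y)).
Definition tensor_mul x y := tclass (TMul (trepr x) (trepr y)).

Lemma tensor_oppE t : tensor_opp (tclass t) = tclass (TOpp t).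
Proof. by apply/tclassP; apply: teq_congrN. Qed.
Lemma tensor_addE t u : tensor_add (tclass t) (tclass u) = tclass (TAdd t u).
Proof. by apply/tclassP; apply: teq_congrD. Qed.
Lemma tensor_mulE t u : tensor_mul (tclass t) (tclass u) = tclass (TMul t u).
Proof. by apply/tclassP; apply: teq_congrM. Qed.

Let tE := (tensor_oppE, tensor_addE, tensor_mulE).

Fact tensor_addA : associative tensor_add.
Proof.
move=> x y z; rewrite -[x]treprK -[y]treprK -[z]treprK !tE.
exact/tclassP/teq_addA.
Qed.
Fact tensor_addC : commutative tensor_add.
Proof.
by move=> x y; rewrite -[x]treprK -[y]treprK !tE; apply/tclassP/teq_addC.
Qed.
Fact tensor_add0 : left_id (tclass (TScal 0)) tensor_add.
Proof. by move=> x; rewrite -[x]treprK !tE; apply/tclassP/teq_add0. Qed.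
Fact tensor_addN : left_inverse (tclass (TScal 0)) tensor_opp tensor_add.
Proof. by move=> x; rewrite -[x]treprK !tE; apply/tclassP/teq_addN. Qed.

HB.instance Definition _ := GRing.isZmodule.Build tensor_alg
  tensor_addA tensor_addC tensor_add0 tensor_addN.

Fact tensor_mulA : associative tensor_mul.
Proof.
move=> x y z; rewrite -[x]treprK -[y]treprK -[z]treprK !tE.
exact/tclassP/teq_mulA.
Qed.
Fact tensor_mul1l : left_id (tclass (TScal 1)) tensor_mul.
Proof. by move=> x; rewrite -[x]treprK !tE; apply/tclassP/teq_mul1l. Qed.
Fact tensor_mul1r : right_id (tclass (TScal 1)) tensor_mul.
Proof. by move=> x; rewrite -[x]treprK !tE; apply/tclassP/teq_mul1r. Qed.
Fact tensor_mulDl : left_distributive tensor_mul +%R.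
Proof.
move=> x y z; rewrite -[x]treprK -[y]treprK -[z]treprK.
rewrite -![_ + _]/(tensor_add _ _) !tE; exact/tclassP/teq_mulDl.
Qed.
Fact tensor_mulDr : right_distributive tensor_mul +%R.
Proof.
move=> x y z; rewrite -[x]treprK -[y]treprK -[z]treprK.
rewrite -![_ + _]/(tensor_add _ _) !tE; exact/tclassP/teq_mulDr.
Qed.

HB.instance Definition _ := GRing.Zmodule_isPzRing.Build tensor_alg
  tensor_mulA tensor_mul1l tensor_mul1r tensor_mulDl tensor_mulDr.

Definition tscal (a : A) : tensor_alg := tclass (TScal a).
Definition tvec (b : B) : tensor_alg := tclass (TVec b).

Lemma tscalD a a' : tscal (a + a') = tscal a + tscal a'.
Proof.
rewrite -[RHS]/(tensor_add _ _) /tscal tE; exact/tclassP/teq_scalD.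
Qed.
Lemma tvecD b b' : tvec (b + b') = tvec b + tvec b'.
Proof.
rewrite -[RHS]/(tensor_add _ _) /tvec tE; exact/tclassP/teq_vecD.
Qed.

Fact tscal_is_zmod_morphism : zmod_morphism tscal.
Proof.
by move=> a a'; apply/eqP; rewrite eq_sym subr_eq -tscalD subrK.
Qed.
Fact tscal_is_monoid_morphism : monoid_morphism tscal.
Proof.
split=> // a a'; rewrite -[RHS]/(tensor_mul _ _) /tscal tE.
exact/tclassP/teq_scalM.
Qed.
Fact tvec_is_zmod_morphism : zmod_morphism tvec.
Proof.
by move=> b b'; apply/eqP; rewrite eq_sym subr_eq -tvecD subrK.
Qed.

HB.instance Definition _ :=
  GRing.isZmodMorphism.Build A tensor_alg tscal tscal_is_zmod_morphism.
HB.instance Definition _ :=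
  GRing.isMonoidMorphism.Build A tensor_alg tscal tscal_is_monoid_morphism.
HB.instance Definition _ :=
  GRing.isZmodMorphism.Build B tensor_alg tvec tvec_is_zmod_morphism.

Lemma tvec_lact a b : tvec (lact a b) = tscal a * tvec b.
Proof.
rewrite -[RHS]/(tensor_mul _ _) /tscal /tvec tE; exact/tclassP/teq_lact.
Qed.
Lemma tvec_ract b a : tvec (ract b a) = tvec b * tscal a.
Proof.
rewrite -[RHS]/(tensor_mul _ _) /tscal /tvec tE; exact/tclassP/teq_ract.
Qed.

Lemma tensor_alg_ind (P : tensor_alg -> Prop) :
  (forall a, P (tscal a)) -> (forall b, P (tvec b)) ->
  (forall x, P x -> P (- x)) ->
  (forall x y, P x -> P y -> P (x + y)) ->
  (forall x y, P x -> P y -> P (x * y)) -> forall x, P x.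
Proof.
move=> Ps Pv PN PD PM x; rewrite -[x]treprK.
elim: (trepr x) => [a|b|t IH|t IHt u IHu|t IHt u IHu].
- exact: Ps.
- exact: Pv.
- by rewrite -tE; apply: PN.
- by rewrite -tE; apply: PD.
- by rewrite -tE; apply: PM.
Qed.

Lemma tensor_alg_universal (Q : pzRingType)
    (f : {rmorphism A -> Q}) (g : {additive B -> Q}) :
  (forall a b, g (lact a b) = f a * g b) ->
  (forall b a, g (ract b a) = g b * f a) ->
  exists! h : tensor_alg -> Q,
    [/\ zmod_morphism h, monoid_morphism h,
        forall a, h (tscal a) = f a & forall b, h (tvec b) = g b].
Proof.
move=> gl gr.
pose ev := fix ev t : Q := match t with
  | TScal a => f a | TVec b => g b | TOpp t => - ev t
  | TAdd t u => ev t + ev u | TMul t u => ev t * ev u end.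
have evP t u : teq t u -> ev t = ev u.
  elim=> //= *; rewrite ?(rmorphD, rmorphM, rmorph0, rmorph1, raddfD) //.
  - by congruence.
  - by congruence.
  - by congruence.
  - by congruence.
  - by rewrite addrA.
  - by rewrite addrC.
  - by rewrite add0r.
  - by rewrite addNr.
  - by rewrite mulrA.
  - by rewrite mul1r.
  - by rewrite mulr1.
  - by rewrite mulrDl.
  - by rewrite mulrDr.
pose h x := ev (trepr x).
have hE t : h (tclass t) = ev t by apply: evP.
have hD x y : h (x + y) = h x + h y.
  by rewrite -[x]treprK -[y]treprK -[_ + _]/(tensor_add _ _) tE !hE.
have hN x : h (- x) = - h x.
  by rewrite -[x]treprK -[- _]/(tensor_opp _) tE !hE.
have hM x y : h (x * y) = h x * h y.
  by rewrite -[x]treprK -[y]treprK -[_ * _]/(tensor_mul _ _) tE !hE.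
have h1 a : h (tscal a) = f a by rewrite hE.
have h2 b : h (tvec b) = g b by rewrite hE.
exists h; split.
  split=> //; first by move=> x y; rewrite hD hN.
  by split=> //; rewrite -[1]/(tscal 1) h1 rmorph1.
move=> k [kB [_ kM] k1 k2].
have k0 : k 0 = 0 by have := kB 0 0; rewrite !subrr.
apply/funext; elim/tensor_alg_ind.
- by move=> a; rewrite h1 k1.
- by move=> b; rewrite h2 k2.
- move=> x IH.
  by rewrite hN IH -[- x]sub0r kB k0 sub0r.
- move=> x y IHx IHy.
  by rewrite hD IHx IHy -[y in RHS]opprK kB -[- y]sub0r kB k0 sub0r opprK.
- by move=> x y IHx IHy; rewrite hM IHx IHy kM.
Qed.

(* Tensor degree d: the image of the d-fold tensor power of B over A. *)
Definition tensor_deg (d : nat) (u : tensor_alg) : Prop :=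
  exists (k : nat) (a : 'I_k -> A) (b : 'I_k -> 'I_d -> B),
    u = \sum_(i < k) tscal (a i) * \prod_(j < d) tvec (b i j).

End TensorAlgebra.

Definition is_ideal (R : comPzRingType) (I : R -> Prop) : Prop :=
  [/\ I 0, forall x y, I x -> I y -> I (x + y) & forall r x, I x -> I (r * x)].

Definition noetherian (R : comPzRingType) : Prop :=
  forall I : R -> Prop, is_ideal I ->
    exists (k : nat) (g : 'I_k -> R),
      forall x, I x <-> exists c : 'I_k -> R, x = \sum_(i < k) c i * g i.

Section RelativeFrobenius.

Variables (R S : comPzRingType) (phi : {rmorphism R -> S}).

Definition is_basis (n : nat) (b : 'I_n -> S) : Prop :=
  forall s : S, exists! c : {ffun 'I_n -> R}, s = \sum_(i < n) phi (c i) * b i.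

Definition R_linear (l : S -> R) : Prop :=
  (forall s t, l (s + t) = l s + l t) /\ (forall r s, l (phi r * s) = r * l s).

Definition hom_act (s : S) (l : S -> R) : S -> R := fun t => l (s * t).

(* [Theta] is an isomorphism of S-modules from S to Hom_R(S, R), where
   Hom_R(S, R) is the set of functions satisfying [R_linear]. *)
Definition hom_iso (Theta : S -> S -> R) : Prop :=
  [/\ forall s, R_linear (Theta s),
      forall s t u, Theta (s + t) u = Theta s u + Theta t u,
      forall s t, Theta (s * t) = hom_act s (Theta t),
      injective Theta
    & forall l, R_linear l -> exists s, Theta s = l].

Definition relative_frobenius (n : nat) : Prop :=
  (exists b : 'I_n -> S, is_basis b) /\ (exists Theta, hom_iso Theta).

Definition hom_generator (lambda : S -> R) : Prop :=
  R_linear lambda /\ forall l, R_linear l -> exists s, l = hom_act s lambda.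

Definition dual_bases (n : nat) (lambda : S -> R) (e f : 'I_n -> S) : Prop :=
  [/\ is_basis e, is_basis f & forall i j, lambda (e i * f j) = (i == j)%:R].

End RelativeFrobenius.

Section Preprojective.

Variables (R S : comPzRingType) (phi : {rmorphism R -> S}).

Lemma bimodMP : bimodule_axioms (A := (R * S)%type) (B := S)
  (fun a m => phi a.1 * m) (fun m a => m * a.2).
Proof.
split=> *; rewrite /= ?(rmorphD, rmorphM, rmorph1);
  by rewrite ?(mulrDl, mulrDr, mulrA, mul1r, mulr1).
Qed.

Lemma bimodNP : bimodule_axioms (A := (R * S)%type) (B := S)
  (fun a m => a.2 * m) (fun m a => m * phi a.1).
Proof.
split=> *; rewrite /= ?(rmorphD, rmorphM, rmorph1);
  by rewrite ?(mulrDl, mulrDr, mulrA, mul1r, mulr1).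
Qed.

(* M is S with R acting on the left and S on the right; N is S with S acting
   on the left and R on the right. *)
Definition bimodM : bimodule (R * S)%type := Bimodule bimodMP.
Definition bimodN : bimodule (R * S)%type := Bimodule bimodNP.

Definition TRS : pzRingType := tensor_alg (bimod_sum bimodM bimodN).

Definition inM (s : S) : TRS := tvec (B := bimod_sum bimodM bimodN) (s, 0).
Definition inN (s : S) : TRS := tvec (B := bimod_sum bimodM bimodN) (0, s).

Variables (n : nat) (e f : 'I_n -> S).

(* Both relations are of tensor degree 2; multiplication in T(R, S) is the
   tensor product over R (+) S. *)
Definition preproj_relations (t : TRS) : Prop :=
  t = inM 1 * inN 1 \/ t = \sum_(i < n) inN (e i) * inM (f i).

Definition preproj : pzRingType := ring_quot preproj_relations.

Definition preproj_proj : {rmorphism TRS -> preproj} :=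
  @quot_proj TRS preproj_relations.

Definition preproj_base (a : R * S) : preproj :=
  preproj_proj (tscal (bimod_sum bimodM bimodN) a).

Definition preproj_scal (r : R) : preproj := preproj_base (r, phi r).

Definition preproj_deg (d : nat) (p : preproj) : Prop :=
  exists t : TRS, tensor_deg d t /\ preproj_proj t = p.

Definition is_central (P : pzRingType) (z : P) : Prop :=
  forall p : P, z * p = p * z.

Definition Z4 (p : preproj) : Prop := is_central p /\ preproj_deg 4 p.

(* Closure under opposites comes from [subalg_scal] at -1. *)
Inductive subalg_gen (X : preproj -> Prop) : preproj -> Prop :=
| subalg_scal r : subalg_gen X (preproj_scal r)
| subalg_mem p : X p -> subalg_gen X p
| subalg_add p q : subalg_gen X p -> subalg_gen X q -> subalg_gen X (p + q)
| subalg_mul p q : subalg_gen X p -> subalg_gen X q -> subalg_gen X (p * q).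

Definition RZ4 : Type := {p : preproj | subalg_gen Z4 p}.

End Preprojective.

(* [Lbasis 0, ..., Lbasis 3] are the letters x, y, z, w. *)
Inductive letter : Type := Lbasis of 'I_4 | Le | Lf.

Definition letter_code (l : letter) : 'I_4 + bool :=
  match l with Lbasis i => inl i | Le => inr true | Lf => inr false end.
Definition letter_decode (c : 'I_4 + bool) : letter :=
  match c with inl i => Lbasis i | inr true => Le | inr false => Lf end.
Lemma letter_codeK : cancel letter_code letter_decode.
Proof. by case. Qed.

HB.instance Definition _ := Equality.copy letter (can_type letter_codeK).
HB.instance Definition _ := Choice.copy letter (can_type letter_codeK).
HB.instance Definition _ := Countable.copy letter (can_type letter_codeK).
HB.instance Definition _ := Finite.copy letter (can_type letter_codeK).

Definition is_arrow (l : letter) : bool := if l is Lbasis _ then false else true.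

(* Letters x, y, z, w are pairwise separated by a letter e or f as soon as no
   two of them are adjacent. *)
Definition may_follow (l l' : letter) : bool :=
  match l, l' with
  | Le, Le | Lf, Lf | Lbasis _, Lbasis _ => false
  | _, _ => true
  end.

Definition word_in_H (u : seq letter) : bool :=
  (count is_arrow u <= 6)%N && sorted may_follow u.

Definition enumerates_H (a : seq (seq letter)) : Prop :=
  uniq a /\ forall u, (u \in a) = word_in_H u.

Lemma size_word_in_H u : word_in_H u -> (size u <= 13)%N.
Proof.
have path_size l v : path may_follow l v ->
    (size v <= (count is_arrow v).*2 + is_arrow l)%N.
  elim: v l => //= l' v IH l /andP[ll' /IH {}IH].
  by move: l l' ll' IH => [?||] [?||] //= _; rewrite doubleD; lia.
case: u => //= l v /andP[/= u6 /path_size].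
by move: u6; case: (is_arrow l); lia.
Qed.

Lemma enumerates_H_exists : exists a, enumerates_H a.
Proof.
exists [seq u <- map val (enum {: 13.-bseq letter}) | word_in_H u]; split.
  by rewrite filter_uniq // map_inj_uniq ?enum_uniq //; apply: val_inj.
move=> u; rewrite mem_filter; case: (boolP (word_in_H u)) => //= Hu.
apply/mapP; exists (Bseq (size_word_in_H Hu)) => //.
by rewrite mem_enum.
Qed.

Section Evaluation.

Variables (R S : comPzRingType) (phi : {rmorphism R -> S}).
Variables (e f b : 'I_4 -> S).

Definition chi_letter (l : letter) : preproj phi e f :=
  match l with
  | Lbasis i => preproj_base phi e f (0, b i)
  | Le => preproj_proj phi e f (inN phi 1)
  | Lf => preproj_proj phi e f (inM phi 1)
  end.

(* The restriction to words of the R-algebra morphism chi. *)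
Definition chi (u : seq letter) : preproj phi e f := \prod_(l <- u) chi_letter l.

Definition sigma (a : seq (seq letter))
    (z : 'I_(size a) -> RZ4 phi e f) : preproj phi e f :=
  \sum_(i < size a) sval (z i) * chi (nth [::] a i).

End Evaluation.

(* Main.v *)
(* Write e, f for the classes of 1 in N, M and <s> = f s e for s in S, so that
   <1> = 0.  In the etale case S = R^4, <s>^2 is a combination of the
   anticommutators of the loops <eps_i> and is central in the corner at R.  In
   general it is completed to a central element of degree 4 of Pi by adding
     q(s) = s e<s>f + e<s>f s + e<s^2 - tr(s) s>f
   in the corner at S.  Only [u, q(s)] = 0 for u in S needs an argument.  With
   s_1, s_2, s_3 the copies of s in S (x) S (x) S, q(s) is the image under
   a (x) b (x) c |-> a e<b>f c of the divided difference at s_1, s_2, s_3 of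
   the characteristic polynomial of s.  By Cayley-Hamilton on the quotient of
   S by the two eigenvectors given by the Casimir element, and by Cramer's
   rule, e_i q(s) e_k - e_k q(s) e_i is then a consequence of the relations.

   Modulo Z_4 the loops anticommute, so e<a><b><c> is alternating in a, b, c
   and vanishes when one of them is 1.  Together with the relation
   sum_i e_i e<f_i> = 0 this shows that it is killed by the kernel of lambda,
   which generates the unit ideal of S.  Hence each product with at least 7
   arrows is a combination, with coefficients in Z_4, of products with 4 arrows
   fewer, and the theorem follows by induction on the number of arrows. *)

From HB Require Import structures.
Require Import Defs.
From mathcomp Require Import all_boot all_algebra.
From mathcomp Require Import ring zify.

Set Implicit Arguments.
Unset Strict Implicit.
Unset Printing Implicit Defensive.

Import GRing.Theory.
Local Open Scope ring_scope.

(** * Indices and sums over ['I_4] *)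

Definition i0 : 'I_4 := @Ordinal 4 0 isT.
Definition i1 : 'I_4 := @Ordinal 4 1 isT.
Definition i2 : 'I_4 := @Ordinal 4 2 isT.
Definition i3 : 'I_4 := @Ordinal 4 3 isT.

Lemma ord4_ind (Q : 'I_4 -> Prop) :
  Q i0 -> Q i1 -> Q i2 -> Q i3 -> forall i, Q i.
Proof.
move=> Q0 Q1 Q2 Q3 [[|[|[|[|m]]]] lt_m4] //.
- by rewrite (_ : Ordinal _ = i0) //; apply: val_inj.
- by rewrite (_ : Ordinal _ = i1) //; apply: val_inj.
- by rewrite (_ : Ordinal _ = i2) //; apply: val_inj.
- by rewrite (_ : Ordinal _ = i3) //; apply: val_inj.
Qed.

Lemma subrACA (V : zmodType) (x y z t : V) : x - y - (z - t) = x - z - (y - t).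
Proof. by rewrite !opprD addrACA. Qed.

Lemma sum4E (V : nmodType) (F : 'I_4 -> V) :
  \sum_(i < 4) F i = F i0 + F i1 + F i2 + F i3.
Proof.
rewrite !big_ord_recl big_ord0 addr0 !addrA.
by congr (F _ + F _ + F _ + F _); apply: val_inj.
Qed.

Lemma sum4_perm (V : nmodType) (F : 'I_4 -> V) p q i k :
  uniq [:: p; q; i; k] -> \sum_(l < 4) F l = F p + F q + F i + F k.
Proof.
move=> uniq_s; rewrite (perm_big [:: p; q; i; k]).
  by rewrite !big_cons big_nil /= addr0 !addrA.
apply: uniq_perm; rewrite ?index_enum_uniq // => l.
have [] := uniq_min_size (s2 := index_enum 'I_4) uniq_s.
- by move=> x _; apply: mem_index_enum.
- by rewrite -sum1_size big_const_ord.
by move=> _ ->.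
Qed.

(** * Polynomial identities for 4-by-4 determinants *)

Section Det4.
Variable R : comPzRingType.
Definition minor2 (a b : 'I_4 -> R) (i j : 'I_4) : R := a i * b j - a j * b i.
(** Laplace expansion along the first two rows. Being an explicit polynomial, it lets [ring] prove
    the identities below over any commutative ring. *)
Definition det4 (a b c d : 'I_4 -> R) : R :=
  minor2 a b i0 i1 * minor2 c d i2 i3 - minor2 a b i0 i2 * minor2 c d i1 i3
  + minor2 a b i0 i3 * minor2 c d i1 i2 + minor2 a b i1 i2 * minor2 c d i0 i3
  - minor2 a b i1 i3 * minor2 c d i0 i2 + minor2 a b i2 i3 * minor2 c d i0 i1.

Definition matvec (m : 'I_4 -> 'I_4 -> R) (a : 'I_4 -> R) (i : 'I_4) : R :=
  m i i0 * a i0 + m i i1 * a i1 + m i i2 * a i2 + m i i3 * a i3.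

(** The derivation that [m] induces on the top exterior power is multiplication by its trace. *)
Lemma det4_trace m a b c d :
  det4 (matvec m a) b c d + det4 a (matvec m b) c d
  + det4 a b (matvec m c) d + det4 a b c (matvec m d)
  = (m i0 i0 + m i1 i1 + m i2 i2 + m i3 i3) * det4 a b c d.
Proof. rewrite /det4 /minor2 /matvec. ring. Qed.

(** The constant is the sum of the principal 2-by-2 minors of [m], that is, a coefficient of its
    characteristic polynomial. *)
Lemma det4_trace2 m a b c d :
  det4 (matvec m a) (matvec m b) c d + det4 (matvec m a) b (matvec m c) d
  + det4 (matvec m a) b c (matvec m d) + det4 a (matvec m b) (matvec m c) d
  + det4 a (matvec m b) c (matvec m d) + det4 a b (matvec m c) (matvec m d)
  = (m i0 i0 * m i1 i1 - m i0 i1 * m i1 i0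
   + (m i0 i0 * m i2 i2 - m i0 i2 * m i2 i0)
   + (m i0 i0 * m i3 i3 - m i0 i3 * m i3 i0)
   + (m i1 i1 * m i2 i2 - m i1 i2 * m i2 i1)
   + (m i1 i1 * m i3 i3 - m i1 i3 * m i3 i1)
   + (m i2 i2 * m i3 i3 - m i2 i3 * m i3 i2)) * det4 a b c d.
Proof. rewrite /det4 /minor2 /matvec. ring. Qed.

(** Cramer's rule without division, as a linear relation between five vectors of a free module of
    rank 4. *)
Lemma det4_cramer a b x v q i :
  det4 a b x v * q i = det4 q b x v * a i + det4 a q x v * b i
    + det4 a b q v * x i + det4 a b x q * v i.
Proof.
rewrite /det4 /minor2; move: i; apply: ord4_ind; ring.
Qed.
End Det4.

(** * Dual bases, the volume form of [S] and the trace of a multiplication *)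

Section DualBases.

Variables (R S : comPzRingType) (phi : {rmorphism R -> S}).
Variables (lambda : S -> R) (e f : 'I_4 -> S).
Hypotheses (lin : R_linear phi lambda) (dual : dual_bases phi lambda e f).

Lemma R_linear_sum (g : S -> R) (c : 'I_4 -> R) (x : 'I_4 -> S) :
  R_linear phi g -> g (\sum_i phi (c i) * x i) = \sum_i c i * g (x i).
Proof. by move=> [gD gZ]; rewrite !sum4E !gD !gZ. Qed.

Lemma expand_f x : x = \sum_i phi (lambda (e i * x)) * f i.
Proof.
have [_ /(_ x)[c [Dx _]] ef] := dual.
rewrite {1}Dx; apply: eq_bigr => i _; congr (phi _ * _).
have -> : e i * x = \sum_k phi (c k) * (e i * f k).
  by rewrite Dx mulr_sumr; apply: eq_bigr => k _; rewrite mulrCA.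
rewrite (R_linear_sum _ _ lin) (bigD1 i) //= ef eqxx mulr1 big1 ?addr0 // => k.
by rewrite ef eq_sym => /negPf->; rewrite mulr0.
Qed.

Lemma expand_e x : x = \sum_i phi (lambda (x * f i)) * e i.
Proof.
have [/(_ x)[c [Dx _]] _ ef] := dual.
rewrite {1}Dx; apply: eq_bigr => i _; congr (phi _ * _).
have -> : x * f i = \sum_k phi (c k) * (e k * f i).
  by rewrite Dx mulr_suml; apply: eq_bigr => k _; rewrite mulrA.
rewrite (R_linear_sum _ _ lin) (bigD1 i) //= ef eqxx mulr1 big1 ?addr0 // => k.
by rewrite ef => /negPf->; rewrite mulr0.
Qed.

(** The element of [S] that represents [g] through the pairing [lambda (x * y)]; see
    [lambda_repr_form]. *)
Definition repr_form (g : S -> R) : S := \sum_i phi (g (f i)) * e i.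

Lemma lambda_repr_form g x : R_linear phi g -> lambda (repr_form g * x) = g x.
Proof.
move=> lin_g; rewrite {2}[x]expand_f (R_linear_sum _ _ lin_g) /repr_form.
rewrite mulr_suml; under eq_bigr => i _ do rewrite -mulrA.
by rewrite (R_linear_sum _ _ lin); apply: eq_bigr => i _; rewrite mulrC.
Qed.

(** Representing forms by elements turns multiplication by [s] in the argument into multiplication
    by [s] in [S]; [act2Ml] and [act2Mr] rest on this. *)
Lemma repr_formM g s :
  R_linear phi g -> repr_form (fun x => g (s * x)) = s * repr_form g.
Proof.
move=> lin_g; rewrite [RHS]expand_e; apply: eq_bigr => i _.
by rewrite -(lambda_repr_form (s * f i) lin_g) mulrA [s * repr_form g]mulrC.
Qed.

Definition coord (x : S) (i : 'I_4) : R := lambda (e i * x).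
Definition vol (a b c d : S) : R :=
  det4 (coord a) (coord b) (coord c) (coord d).

Lemma coordD a b i : coord (a + b) i = coord a i + coord b i.
Proof. by rewrite /coord mulrDr lin.1. Qed.

Lemma coordZ r a i : coord (phi r * a) i = r * coord a i.
Proof. by rewrite /coord mulrCA lin.2. Qed.

Lemma coord_f i k : coord (f i) k = (k == i)%:R.
Proof. by rewrite /coord; have [_ _ ->] := dual. Qed.

Definition mulmat (s : S) (i k : 'I_4) : R := lambda (e i * (s * f k)).

Lemma coordM s a : coord (s * a) =1 matvec (mulmat s) (coord a).
Proof.
move=> i; rewrite /coord {1}[a]expand_f mulr_sumr mulr_sumr.
under eq_bigr => k _ do rewrite [s * _]mulrCA [e i * _]mulrCA.
rewrite (R_linear_sum _ _ lin) sum4E /matvec /mulmat /coord.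
by rewrite ![lambda (_ * (s * _)) * _]mulrC.
Qed.

Lemma vol_lin1 b c d : R_linear phi (fun a => vol a b c d).
Proof.
by split=> *; rewrite /vol /det4 /minor2 !(coordD, coordZ); ring.
Qed.

Lemma vol_lin2 a c d : R_linear phi (fun b => vol a b c d).
Proof.
by split=> *; rewrite /vol /det4 /minor2 !(coordD, coordZ); ring.
Qed.

Lemma vol_antisym a b x v : vol a b x v = - vol a b v x.
Proof. by rewrite /vol /det4 /minor2; ring. Qed.

Definition trace (s : S) : R :=
  mulmat s i0 i0 + mulmat s i1 i1 + mulmat s i2 i2 + mulmat s i3 i3.

Lemma vol_trace s a b c d :
  vol (s * a) b c d + vol a (s * b) c d + vol a b (s * c) d + vol a b c (s * d)
  = trace s * vol a b c d.
Proof.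
by rewrite -det4_trace /vol /det4 /minor2 !coordM.
Qed.

(** The constant depends only on [s]: unification with [det4_trace2] supplies the sum of the
    principal 2-by-2 minors of [mulmat s]. *)
Lemma vol_trace2 s : exists c2 : R, forall a b c d,
  vol (s * a) (s * b) c d + vol (s * a) b (s * c) d + vol (s * a) b c (s * d)
  + vol a (s * b) (s * c) d + vol a (s * b) c (s * d) + vol a b (s * c) (s * d)
  = c2 * vol a b c d.
Proof.
eexists => a b c d; apply: etrans; last exact: (det4_trace2 (mulmat s)).
by rewrite /vol /det4 /minor2 !coordM.
Qed.

Lemma vol_cramer a b x v q :
  phi (vol a b x v) * q = phi (vol q b x v) * a + phi (vol a q x v) * b
    + phi (vol a b q v) * x + phi (vol a b x q) * v.
Proof.
rewrite [LHS]expand_f [RHS]expand_f; apply: eq_bigr => i _; congr (phi _ * _).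
rewrite -!/(coord _ _) !(coordD, coordZ); exact: det4_cramer.
Qed.

End DualBases.

(** * Bilinear forms as elements of the tensor square of [S], acting on an [S]-bimodule *)

Section BimoduleIdentity.

Variables (R S : comPzRingType) (phi : {rmorphism R -> S}).
Variables (lambda : S -> R) (e f : 'I_4 -> S).
Hypotheses (lin : R_linear phi lambda) (dual : dual_bases phi lambda e f).
Variables (P : pzRingType) (j E : {additive S -> P}).
Hypothesis jM : forall a b, j (a * b) = j a * j b.
Hypothesis E_scall : forall r q, E (phi r * q) = j (phi r) * E q.
Hypothesis E_scalr : forall r q, E (phi r * q) = E q * j (phi r).
Hypothesis E1 : E 1 = 0.
Hypothesis casimir_l : \sum_i j (e i) * E (f i) = 0.
Hypothesis casimir_r : \sum_i E (f i) * j (e i) = 0.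
Hypothesis E_unitl : forall q, j 1 * E q = E q.
Hypothesis E_unitr : forall q, E q * j 1 = E q.

Local Notation vol := (vol lambda e).

(* [B] is a bilinear form on the dual of [S]: its values on the basis [f] are
   the coefficients of an element of [S (x)_R S], which acts on [n]. *)
Definition act2 (B : S -> S -> R) (n : P) : P :=
  \sum_i \sum_k j (phi (B (f i) (f k)) * e i) * n * j (e k).

Lemma eq_act2 B B' n : (forall a b, B a b = B' a b) -> act2 B n = act2 B' n.
Proof. by move=> eqB; do 2!apply: eq_bigr => ? _; rewrite eqB. Qed.

Lemma act2D B B' n :
  act2 (fun a b => B a b + B' a b) n = act2 B n + act2 B' n.
Proof.
rewrite -big_split; apply: eq_bigr => i _; rewrite -big_split.
by apply: eq_bigr => k _; rewrite rmorphD mulrDl raddfD !mulrDl.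
Qed.

Lemma act2N B n : act2 (fun a b => - B a b) n = - act2 B n.
Proof.
rewrite -sumrN; apply: eq_bigr => i _; rewrite -sumrN.
by apply: eq_bigr => k _; rewrite rmorphN mulNr raddfN !mulNr.
Qed.

Lemma act2Z r B n : act2 (fun a b => r * B a b) n = j (phi r) * act2 B n.
Proof.
rewrite mulr_sumr; apply: eq_bigr => i _; rewrite mulr_sumr.
by apply: eq_bigr => k _; rewrite !mulrA -jM rmorphM mulrA.
Qed.

Lemma act2_addn B m n : act2 B (m + n) = act2 B m + act2 B n.
Proof.
rewrite -big_split; apply: eq_bigr => i _; rewrite -big_split.
by apply: eq_bigr => k _; rewrite mulrDr mulrDl.
Qed.

Lemma act2_oppn B n : act2 B (- n) = - act2 B n.
Proof.
rewrite -sumrN; apply: eq_bigr => i _; rewrite -sumrN.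
by apply: eq_bigr => k _; rewrite mulrN mulNr.
Qed.

Lemma act2_mulln B s n : act2 B (j s * n) = j s * act2 B n.
Proof.
rewrite mulr_sumr; apply: eq_bigr => i _; rewrite mulr_sumr.
by apply: eq_bigr => k _; rewrite !mulrA -!jM [s * _]mulrC.
Qed.

Lemma act2_mulrn B s n : act2 B (n * j s) = act2 B n * j s.
Proof.
rewrite mulr_suml; apply: eq_bigr => i _; rewrite mulr_suml.
by apply: eq_bigr => k _; rewrite -!mulrA -!jM [s * _]mulrC.
Qed.

Lemma act2Ml B s n : (forall b, R_linear phi (B^~ b)) ->
  act2 (fun a b => B (s * a) b) n = j s * act2 B n.
Proof.
move=> linB; rewrite /act2 exchange_big [in RHS]exchange_big mulr_sumr.
apply: eq_bigr => k _; rewrite -!mulr_suml -!raddf_sum /= !mulrA -jM.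
by congr (j _ * _ * _); apply: (repr_formM lin dual s (linB (f k))).
Qed.

(** [act2] places the coefficients of the form to the left of [n]; this condition lets them cross to
    the right factor. *)
Definition scal_central (n : P) : Prop :=
  forall r, j (phi r) * n = n * j (phi r).

Lemma act2_rightE B n : scal_central n ->
  act2 B n = \sum_i j (e i) * n * j (repr_form phi e f (B (f i))).
Proof.
move=> cn; apply: eq_bigr => i _; rewrite raddf_sum mulr_sumr.
apply: eq_bigr => k _; rewrite mulrC jM -[_ * j (phi _) * n]mulrA cn.
by rewrite jM !mulrA.
Qed.

Lemma act2Mr B s n : scal_central n -> (forall a, R_linear phi (B a)) ->
  act2 (fun a b => B a (s * b)) n = act2 B n * j s.
Proof.
move=> cn linB; rewrite !act2_rightE // mulr_suml; apply: eq_bigr => i _.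
by rewrite (repr_formM lin dual) // mulrC jM mulrA.
Qed.

(** Through [lambda], a product of two linear forms corresponds to the pure tensor of [u] and
    [v]. *)
Lemma act2_pure u v n : scal_central n ->
  act2 (fun a b => lambda (u * a) * lambda (v * b)) n = j u * n * j v.
Proof.
move=> cn; rewrite act2_rightE // {2}(expand_e lin dual u) raddf_sum !mulr_suml.
apply: eq_bigr => i _.
have -> : repr_form phi e f (fun b => lambda (u * f i) * lambda (v * b))
    = phi (lambda (u * f i)) * v.
  rewrite {2}(expand_e lin dual v) mulr_sumr; apply: eq_bigr => k _.
  by rewrite rmorphM mulrA.
by rewrite [phi _ * e i]mulrC !jM mulrA -[j (e i) * n * _]mulrA -cn !mulrA.
Qed.

Lemma scal_central_E q : scal_central (E q).
Proof. by move=> r; rewrite -E_scall E_scalr. Qed.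

(** * The element attached to [s] that commutes with [S] *)

Section Square.

Variable s : S.

(* If the left and right actions of [s] are its conjugates [s_1] and [s_3],
   this is multiplication by [s_2 + s_4 = trace s - s_1 - s_3]. *)
Definition cotrace (n : P) : P :=
  j (phi (trace lambda e f s)) * n - j s * n - n * j s.

Definition square_elt : P := E (s * s) - cotrace (E s).

Let om n q v := act2 (fun a b => vol a b q v) n.

Let lin1 q v b : R_linear phi (fun a => vol a b q v).
Proof. exact: vol_lin1. Qed.
Let lin2 q v a : R_linear phi (fun b => vol a b q v).
Proof. exact: vol_lin2. Qed.

Lemma cotraceB : zmod_morphism cotrace.
Proof.
move=> x y; rewrite /cotrace !mulrBr mulrBl [RHS]subrACA; congr (_ - _).
exact: subrACA.
Qed.

(** In [vol_trace], the terms with [s] in the first two slots become left and right multiplication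
    by [s]. What remains of the trace is [cotrace]. *)
Lemma act2_trace n q v : scal_central n ->
  om n (s * q) v + om n q (s * v) = cotrace (om n q v).
Proof.
move=> cn; rewrite /cotrace -act2Z.
rewrite -(act2Mr (B := fun a b => vol a b q v)) //.
rewrite -(act2Ml (B := fun a b => vol a b q v)) // -!act2N -!act2D.
apply: eq_act2 => a b; rewrite -(vol_trace lin dual); ring.
Qed.

(** [H] is found by solving [vol_trace2] for the term with [s] in the last two slots; the other
    terms are expressed by [act2Ml], [act2Mr] and [act2_trace]. The point is that [H] is additive
    and the same for all [n], [q], [v]. *)
Lemma act2_trace2 : exists2 H : P -> P, zmod_morphism H &
  forall n q v, scal_central n -> om n (s * q) (s * v) = H (om n q v).
Proof.
have [c2 vol2] := vol_trace2 lin dual s.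
exists (fun w => j (phi c2) * w - j s * cotrace w - cotrace w * j s
                 - j s * w * j s).
  move=> x y; rewrite cotraceB !mulrBr !mulrBl.
  rewrite [RHS]subrACA [X in _ = X - _]subrACA; congr (_ - _ - _).
  exact: subrACA.
move=> n q v cn.
rewrite -!act2_trace // mulrDl mulrDr !opprD.
rewrite -act2Z -!(act2Ml (B := fun a b => vol a b _ _)) //.
rewrite -!(act2Mr (B := fun a b => vol _ _ _ _)) // -!act2N -!act2D.
apply: eq_act2 => a b; rewrite -vol2; ring.
Qed.

(** Expand [q] by Cramer's rule in [a], [b], [x], [v]. The terms along [a] and [b] ([t1] and [t2])
    contain the left and right Casimir sums and vanish; those along [x] and [v] remain. *)
Lemma act2_cramer x v q : act2 (fun a b => vol a b x v) (E q)
  = om (E x) q v - om (E v) q x.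
Proof.
pose t1 i k := j (e i) * E (phi (vol q (f k) x v) * f i) * j (e k).
pose t2 i k := j (e i) * E (phi (vol (f i) q x v) * f k) * j (e k).
pose t3 y z i k := j (phi (vol (f i) (f k) q z) * e i) * E y * j (e k).
have -> : act2 (fun a b => vol a b x v) (E q) =
    \sum_i \sum_k (t1 i k + t2 i k + t3 x v i k - t3 v x i k).
  apply: eq_bigr => i _; apply: eq_bigr => k _.
  rewrite /t1 /t2 /t3 ![phi _ * e i]mulrC !jM -!(mulrA (j (e i)) (j (phi _))).
  rewrite -!E_scall (vol_cramer lin dual _ _ _ _ q) (vol_antisym _ _ _ _ x q).
  by rewrite rmorphN mulNr raddfB !raddfD !(mulrBr, mulrDr) !(mulrBl, mulrDl).
have t1_0 : \sum_i \sum_k t1 i k = 0.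
  rewrite exchange_big big1 // => k _; rewrite -mulr_suml.
  under eq_bigr => i _ do rewrite E_scalr mulrA.
  by rewrite -mulr_suml casimir_l !mul0r.
have t2_0 : \sum_i \sum_k t2 i k = 0.
  rewrite big1 // => i _.
  under eq_bigr => k _ do rewrite /t2 E_scall mulrA -mulrA.
  by rewrite -mulr_sumr casimir_r mulr0.
under eq_bigr => i _ do rewrite !big_split sumrN.
rewrite /= !big_split sumrN /= t1_0 t2_0 !add0r.
by [].

Qed.

(** By [act2_cramer] everything is expressed through [E x] and [E v]. The two trace identities then
    collect it into [H] applied to the Cramer expression with [q = 1], which is zero because
    [E 1 = 0]. *)
Lemma act2_square x v : act2 (fun a b => vol a b x v) square_elt = 0.
Proof.
have [H HB om2] := act2_trace2.
have H0 : H 0 = 0 by have := HB 0 0; rewrite !subrr.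
have om_B n m q w : om (n - m) q w = om n q w - om m q w.
  by rewrite /om act2_addn act2_oppn.
(* [act2_trace] at [q = s] leaves the term with [s] in both slots, which is [H] of the term with [1]
   and [w] by [act2_trace2]. *)
have red n w : scal_central n ->
    om n (s * s) w - cotrace (om n s w) = - H (om n 1 w).
  by move=> cn; rewrite -act2_trace // -om2 // mulr1 opprD addNKr.
rewrite /square_elt /cotrace -/(om _ _ _) !om_B.
rewrite /om !act2_mulln !act2_mulrn.
rewrite -/(cotrace (act2 _ _)) !act2_cramer cotraceB subrACA.
rewrite !red; try exact: scal_central_E.
rewrite -opprD -HB -act2_cramer E1 /act2 big1 ?H0 ?oppr0 // => i _.
by rewrite big1 // => k _; rewrite mulr0 mul0r.
Qed.

Lemma scal_central_square : scal_central square_elt.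
Proof.
move=> r; have comm n t : scal_central n -> scal_central (j t * n)
    /\ scal_central (n * j t).
  move=> cn; split=> u; first by rewrite mulrA -jM mulrC jM -mulrA cn mulrA.
  by rewrite mulrA cn -!mulrA -!jM mulrC.
have cE := scal_central_E s.
rewrite /square_elt /cotrace !mulrBr !mulrBl.
congr (_ - (_ - _ - _)); first exact: scal_central_E.
- by have [->] := comm _ (phi (trace lambda e f s)) cE.
- by have [->] := comm _ s cE.
- by have [_ ->] := comm _ s cE.
Qed.

Lemma square_elt_unitl : j 1 * square_elt = square_elt.
Proof.
by rewrite /square_elt /cotrace !mulrBr E_unitl !mulrA -!jM !mul1r E_unitl.
Qed.

Lemma square_elt_unitr : square_elt * j 1 = square_elt.
Proof.
by rewrite /square_elt /cotrace !mulrBl -!mulrA !E_unitr -jM mulr1.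
Qed.

(** When [x] and [v] are the two complementary vectors of the basis [f], [vol a b x v] is a 2-by-2
    minor, hence a difference of two pure tensors, and [act2_square] applies. *)
Lemma square_elt_swap i k :
  j (e i) * square_elt * j (e k) = j (e k) * square_elt * j (e i).
Proof.
have cZ := scal_central_square.
pose swap_at m n :=
  j (e m) * square_elt * j (e n) = j (e n) * square_elt * j (e m).
have swap (m n : 'I_4) x v :
    (forall a b, vol a b x v = coord lambda e a m * coord lambda e b n
                               - coord lambda e a n * coord lambda e b m) ->
    swap_at m n.
  move=> volE; apply/eqP; rewrite -subr_eq0 -!act2_pure // -act2N -act2D.
  by rewrite -(act2_square x v); apply/eqP/eq_act2 => a b; rewrite volE.
(* In each case [x] and [v] are ordered so that the minor appears with sign [+]. *)
have [s01 s02 s03] : [/\ swap_at i0 i1, swap_at i0 i2 & swap_at i0 i3].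
  split; [apply: (swap _ _ (f i2) (f i3)) | apply: (swap _ _ (f i3) (f i1))
         | apply: (swap _ _ (f i1) (f i2))] => a b;
  by rewrite /vol /det4 /minor2 !(coord_f dual) /=; ring.
have [s12 s13 s23] : [/\ swap_at i1 i2, swap_at i1 i3 & swap_at i2 i3].
  split; [apply: (swap _ _ (f i0) (f i3)) | apply: (swap _ _ (f i2) (f i0))
         | apply: (swap _ _ (f i0) (f i1))] => a b;
  by rewrite /vol /det4 /minor2 !(coord_f dual) /=; ring.
by move: i k; do 2!apply: ord4_ind.
Qed.

(** Both sides are [act2] of pure tensors, [u] with [1] and [1] with [u]; their expansions are
    exchanged by swapping [i] and [k]. *)
Lemma square_elt_comm u : j u * square_elt = square_elt * j u.
Proof.
have cZ := scal_central_square.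
rewrite -{2}square_elt_unitl -{1}square_elt_unitr mulrA -!act2_pure //.
rewrite /act2 [RHS]exchange_big; apply: eq_bigr => i _; apply: eq_bigr => k _.
rewrite !jM -!mulrA !(mulrA (j (e _))) square_elt_swap.
by rewrite [_ * lambda (u * _)]mulrC.
Qed.

End Square.
End BimoduleIdentity.

(** * The ideal generated by the kernel of [lambda] *)

Section AlternatingForms.

Variables (R S : comPzRingType) (phi : {rmorphism R -> S}).
Variables (lambda : S -> R) (e f : 'I_4 -> S).
Hypotheses (lin : R_linear phi lambda) (dual : dual_bases phi lambda e f).

(* Modulo [J], the diagonal products [e i * f i] have a common value, which
   kills every [e k]. *)
Lemma ker_ideal_full (J : S -> Prop) :
  (forall x y, J x -> J y -> J (x + y)) -> (forall x y, J y -> J (x * y)) ->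
  (forall x, lambda x = 0 -> J x) -> J 1.
Proof.
move=> JD JM Jker; have [_ _ ef] := dual.
have lambda0 : lambda 0 = 0 by have := lin.2 0 0; rewrite rmorph0 !mul0r.
have Jsum (x : 'I_4 -> S) : (forall i, J (x i)) -> J (\sum_i x i).
  by move=> Jx; rewrite sum4E; auto.
have lambdaB x y : lambda (x - y) = lambda x - lambda y.
  by rewrite lin.1 -mulN1r -(rmorph1 phi) -rmorphN lin.2 mulN1r.
have Joff i k : i != k -> J (e i * f k).
  by move=> /negPf ik; apply: Jker; rewrite ef ik.
have Jdiff i k : J (e i * f i - e k * f k).
  by apply: Jker; rewrite lambdaB !ef !eqxx subrr.
have Jdiag_e i : J (e i0 * f i0 * e i).
  have [->|i_neq0] := eqVneq i i0; last first.
    by rewrite -mulrA [f i0 * _]mulrC; apply/JM/Joff.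
  rewrite -[e i0 * f i0](subrK (e i1 * f i1)) mulrDl; apply/JD.
    by rewrite mulrC; apply/JM/Jdiff.
  by rewrite -mulrA [f i1 * _]mulrC; apply/JM/Joff.
have Jdiag : J (e i0 * f i0).
  rewrite -[_ * _]mulr1 [X in _ * X](expand_e lin dual) mulr_sumr.
  by apply/Jsum => i; rewrite mulrCA; apply/JM.
have Jef i k : J (e i * f k).
  have [->|] := eqVneq i k; last exact: Joff.
  by rewrite -[_ * _](subrK (e i0 * f i0)); apply/JD.
rewrite -(mulr1 1) [X in X * _](expand_e lin dual).
rewrite [X in _ * X](expand_f lin dual) mulr_suml.
apply/Jsum => i; rewrite mulr_sumr; apply/Jsum => k.
by rewrite mulrACA; apply/JM.
Qed.

(** * Trilinear forms that alternate modulo a submodule [K]; [act 1] need not be the identity on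
    [V] *)

Variables (V : zmodType) (act : S -> V -> V) (K : V -> Prop).
Hypothesis actDl : forall a b x, act (a + b) x = act a x + act b x.
Hypothesis actDr : forall a x y, act a (x + y) = act a x + act a y.
Hypothesis actM : forall a b x, act (a * b) x = act a (act b x).
Hypothesis K0 : K 0.
Hypothesis KB : forall x y, K x -> K y -> K (x - y).
Hypothesis K_act : forall a x, K x -> K (act a x).

Variable W : S -> S -> S -> V.
Hypothesis WD1 : forall a a' b c, W (a + a') b c = W a b c + W a' b c.
Hypothesis WD2 : forall a b b' c, W a (b + b') c = W a b c + W a b' c.
Hypothesis WD3 : forall a b c c', W a b (c + c') = W a b c + W a b c'.
Hypothesis WZ1 : forall r a b c, W (phi r * a) b c = act (phi r) (W a b c).
Hypothesis WZ2 : forall r a b c, W a (phi r * b) c = act (phi r) (W a b c).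
Hypothesis WZ3 : forall r a b c, W a b (phi r * c) = act (phi r) (W a b c).
Hypothesis W1 : forall b c, W 1 b c = 0.
Hypothesis W_unit : forall a b c, act 1 (W a b c) = W a b c.
Hypothesis KW12 : forall a c, K (W a a c).
Hypothesis KW23 : forall a b, K (W a b b).
Hypothesis W_casimir : forall b c, \sum_i act (e i) (W (f i) b c) = 0.

Definition eqK x y := K (x - y).

Let KN x : K x -> K (- x). Proof. by rewrite -sub0r; apply: KB. Qed.
Let KD x y : K x -> K y -> K (x + y).
Proof. by move=> Kx Ky; rewrite -[y]opprK; apply/KB/KN. Qed.
Let Ksum (x : 'I_4 -> V) : (forall i, K (x i)) -> K (\sum_i x i).
Proof. by move=> Kx; rewrite sum4E; auto. Qed.
Let act0 x : act 0 x = 0.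
Proof. by apply: (addrI (act 0 x)); rewrite -actDl !addr0. Qed.
Let actx0 a : act a 0 = 0.
Proof. by apply: (addrI (act a 0)); rewrite -actDr !addr0. Qed.
Let actN a x : act a (- x) = - act a x.
Proof. by apply: (addrI (act a x)); rewrite -actDr !subrr actx0. Qed.
Let act_suml (a : 'I_4 -> S) x : act (\sum_i a i) x = \sum_i act (a i) x.
Proof. by rewrite !sum4E !actDl. Qed.
Let act_sumr a (x : 'I_4 -> V) : act a (\sum_i x i) = \sum_i act a (x i).
Proof. by rewrite !sum4E !actDr. Qed.

Let eqK_refl x : eqK x x. Proof. by rewrite /eqK subrr. Qed.
Let eqK_sym x y : eqK x y -> eqK y x.
Proof. by rewrite /eqK => /KN; rewrite opprB. Qed.
Let eqK_trans x y z : eqK x y -> eqK y z -> eqK x z.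
Proof. by rewrite /eqK => Kxy /(KD Kxy); rewrite addrA subrK. Qed.
Let eqK_act a x y : eqK x y -> eqK (act a x) (act a y).
Proof. by move=> /(K_act a); rewrite actDr actN. Qed.
Let eqK_N x y : eqK x y -> eqK (- x) (- y).
Proof. by rewrite /eqK => /KN; rewrite opprD. Qed.
Let eqK_K x y : eqK x y -> K y -> K x.
Proof. by move=> Kxy /(KD Kxy); rewrite subrK. Qed.

Let W_swap12 a b c : eqK (W a b c) (- W b a c).
Proof.
rewrite /eqK opprK; have := KB (KB (KW12 (a + b) c) (KW12 a c)) (KW12 b c).
rewrite WD1 !WD2 addrAC addrA addrK -(addrA (W a a c)).
by rewrite [X in X - _]addrC addrK.
Qed.

Let W_swap23 a b c : eqK (W a b c) (- W a c b).
Proof.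
rewrite /eqK opprK; have := KB (KB (KW23 a (b + c)) (KW23 a b)) (KW23 a c).
rewrite WD2 !WD3 addrAC addrA addrK -(addrA (W a b b)).
by rewrite [X in X - _]addrC addrK.
Qed.

Let W_rot a b c : eqK (W a b c) (W b c a).
Proof.
apply: eqK_trans (W_swap12 a b c) _.
by rewrite -[W b c a]opprK; apply/eqK_N/W_swap23.
Qed.

(* The signs make [cofactor_swap] independent of the order of the indices. *)
Definition cofactor4 : 'I_4 -> V := fun i =>
  match val i with
  | 0 => W (f i1) (f i2) (f i3) | 1 => - W (f i0) (f i2) (f i3)
  | 2 => W (f i0) (f i1) (f i3) | _ => - W (f i0) (f i1) (f i2) end%N.

(** Take [b] and [c] to be the two remaining vectors of [f]. Their own terms in the sum have a
    repeated argument and lie in [K], which leaves a relation between the terms of [i] and [k]. *)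
Lemma cofactor_swap (a : 'I_4 -> S) :
  (forall b c, \sum_i act (a i) (W (f i) b c) = 0) ->
  forall i k, eqK (act (a i) (cofactor4 k)) (act (a k) (cofactor4 i)).
Proof.
move=> a0.
have swap i k p q : uniq [:: p; q; i; k] ->
    eqK (W (f i) (f p) (f q)) (- cofactor4 k) ->
    eqK (W (f k) (f p) (f q)) (cofactor4 i) ->
    eqK (act (a i) (cofactor4 k)) (act (a k) (cofactor4 i)).
  move=> /(sum4_perm (fun l => act (a l) (W (f l) (f p) (f q)))).
  rewrite a0 => sum0 Wi Wk; apply: eqK_trans _ (eqK_act _ Wk).
  have /eqK_sym : eqK (act (a i) (W (f i) (f p) (f q)))
                      (- act (a i) (cofactor4 k)).
    by rewrite -actN; apply: eqK_act.
  move=> /eqK_N; rewrite opprK => /eqK_trans; apply.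
  rewrite /eqK -opprD; apply: KN.
  have Kq : K (W (f q) (f p) (f q)).
    apply: eqK_K (W_swap12 _ _ _) _; exact/KN/KW23.
  rewrite (_ : _ + _ = - (act (a p) (W (f p) (f p) (f q))
                          + act (a q) (W (f q) (f p) (f q)))).
    by apply/KN/KD; apply: K_act.
  by apply/eqP; rewrite -addr_eq0 addrC addrA -sum0.
pose swap_at i k := eqK (act (a i) (cofactor4 k)) (act (a k) (cofactor4 i)).
have W_rot2 x y z : eqK (W x y z) (W z x y).
  exact: eqK_trans (W_rot _ _ _) (W_rot _ _ _).
(* The order of the complementary pair is chosen so that both sign conditions of [swap] hold, up to
   [W_rot] and [W_swap23]. *)
have s01 : swap_at i0 i1.
  by apply: (swap _ _ i2 i3); rewrite /cofactor4 ?opprK.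
have s02 : swap_at i0 i2.
  by apply: (swap _ _ i3 i1); rewrite /cofactor4.
have s03 : swap_at i0 i3.
  by apply: (swap _ _ i1 i2); rewrite /cofactor4 ?opprK.
have s12 : swap_at i1 i2.
  by apply: (swap _ _ i0 i3); rewrite /cofactor4.
have s13 : swap_at i1 i3.
  apply: (swap _ _ i2 i0); rewrite /cofactor4 ?opprK //=.
  exact: eqK_trans (W_rot2 _ _ _) (W_swap23 _ _ _).
have s23 : swap_at i2 i3.
  by apply: (swap _ _ i0 i1); rewrite /cofactor4 ?opprK.
have self i : swap_at i i by exact: eqK_refl.
by do 2!apply: ord4_ind; try assumption; apply: eqK_sym.
Qed.

(** The sum over [i] is the [R]-linear extension of [e i |-> cofactor4 i], so bilinearity reduces
    the claim to [cofactor_swap]. *)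
Lemma cofactor_lin_swap (h : S -> S) :
  (forall c (x : 'I_4 -> S),
     h (\sum_i phi (c i) * x i) = \sum_i phi (c i) * h (x i)) ->
  (forall b c, \sum_i act (h (e i)) (W (f i) b c) = 0) ->
  forall x y,
    eqK (act (h x) (\sum_i act (phi (lambda (y * f i))) (cofactor4 i)))
        (act (h y) (\sum_i act (phi (lambda (x * f i))) (cofactor4 i))).
Proof.
move=> h_lin h_casimir x y; rewrite /eqK.
rewrite {1}(expand_e lin dual x) {2}(expand_e lin dual y) !h_lin.
rewrite !act_suml; under eq_bigr => i _ do rewrite act_sumr.
rewrite exchange_big -sumrB; apply: Ksum => k.
rewrite act_sumr -sumrB; apply: Ksum => i; rewrite -!actM.
have -> : phi (lambda (x * f i)) * h (e i) * phi (lambda (y * f k))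
   = phi (lambda (x * f i)) * phi (lambda (y * f k)) * h (e i) by ring.
have -> : phi (lambda (y * f k)) * h (e k) * phi (lambda (x * f i))
   = phi (lambda (x * f i)) * phi (lambda (y * f k)) * h (e k) by ring.
rewrite !(actM (_ * _)).
exact: (eqK_act _ (cofactor_swap (a := fun i => h (e i)) h_casimir i k)).
Qed.

(** With [w] the linear extension of the cofactors, [x w(y)] and [lambda(x) w(y)] are both symmetric
    in [x], [y] modulo [K]. Hence the kernel of [lambda] sends [w 1] into [K], and by
    [ker_ideal_full] so does [1]. *)
Lemma cofactor_mem i : K (cofactor4 i).
Proof.
pose w x := \sum_i act (phi (lambda (x * f i))) (cofactor4 i).
have w_swap x y : eqK (act x (w y)) (act y (w x)).
  by apply: (cofactor_lin_swap (h := id)).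
have lambda_lin c x := R_linear_sum c x lin.
have w_lambda x y :
    eqK (act (phi (lambda x)) (w y)) (act (phi (lambda y)) (w x)).
  apply: (cofactor_lin_swap (h := fun x => phi (lambda x))) => [c z|b c].
    by rewrite lambda_lin rmorph_sum; apply: eq_bigr => k _; rewrite rmorphM.
  (* Since [1] is the sum of the [lambda (e k) f k], the Casimir condition for [lambda] becomes
     [W 1 b c = 0]. *)
  under eq_bigr => k _ do rewrite -WZ1 -[e k]mulr1.
  by rewrite -[RHS](W1 b c) [in RHS](expand_f lin dual 1) !sum4E !WD1.
have [_ _ ef] := dual.
have K1w x : lambda x = 0 -> K (act 1 (w x)).
  (* [e i0 * f i0] serves as an element on which [lambda] is [1]. *)
  move=> x0; have := w_lambda (e i0 * f i0) x.
  by rewrite ef eqxx x0 rmorph1 rmorph0 act0 /eqK subr0.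
have K1 : K (act 1 (w 1)).
  apply: (ker_ideal_full (J := fun x => K (act x (w 1))))
    => [x y Kx Ky|x y Ky|x x0].
  - by rewrite actDl; apply: KD.
  - by rewrite actM; apply: K_act.
  - exact: eqK_K (w_swap x 1) (K1w _ x0).
have wE : w (e i) = act 1 (cofactor4 i).
  rewrite /w (bigD1 i) //= ef eqxx rmorph1 big1 ?addr0 // => k ki.
  by rewrite ef eq_sym (negPf ki) rmorph0 act0.
have act1_cof k : act 1 (cofactor4 k) = cofactor4 k.
  by move: k; apply: ord4_ind; rewrite /cofactor4 /= ?actN W_unit.
(* One [act 1] is needed to recognize [w (e i)], the other to apply [w_swap] at [1] and [e i]. *)
rewrite -act1_cof -act1_cof -wE; apply: eqK_K (w_swap 1 (e i)) _.
by rewrite -[e i]mulr1 actM; apply: K_act.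
Qed.

Lemma alternating_mem a b c : K (W a b c).
Proof.
have sw12 x y z : K (W x y z) -> K (W y x z).
  by move=> /KN; apply: eqK_K.
have sw23 x y z : K (W x y z) -> K (W x z y).
  by move=> /KN; apply: eqK_K.
have h0 : K (W (f i1) (f i2) (f i3)) by exact: (cofactor_mem i0).
have h1 : K (W (f i0) (f i2) (f i3))
  by rewrite -[W _ _ _]opprK; exact/KN/(cofactor_mem i1).
have h2 : K (W (f i0) (f i1) (f i3)) by exact: (cofactor_mem i2).
have h3 : K (W (f i0) (f i1) (f i2))
  by rewrite -[W _ _ _]opprK; exact/KN/(cofactor_mem i3).
(* Adjacent transpositions sort distinct indices into one of [h0], ..., [h3], and bring repeated
   ones together for [KW12] or [KW23]. *)
have Kf i k l : K (W (f i) (f k) (f l)).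
  by move: i k l; do 3!apply: ord4_ind; auto 6.
rewrite (expand_f lin dual a) (expand_f lin dual b) (expand_f lin dual c).
rewrite sum4E !WD1; do 3?apply: KD; rewrite WZ1; apply: K_act;
rewrite sum4E !WD2; do 3?apply: KD; rewrite WZ2; apply: K_act;
by rewrite sum4E !WD3; do 3?apply: KD; rewrite WZ3; apply: K_act.
Qed.

End AlternatingForms.

(** * Additive subgroups generated by a predicate *)

Inductive add_span (V : zmodType) (X : V -> Prop) : V -> Prop :=
| add_span0 : add_span X 0
| add_span_mem x : X x -> add_span X x
| add_spanB x y : add_span X x -> add_span X y -> add_span X (x - y).

Section AddSpan.

Variables (V : zmodType) (X : V -> Prop).

Lemma add_spanD x y : add_span X x -> add_span X y -> add_span X (x + y).
Proof.
move=> Xx Xy; rewrite -[y]opprK -[- y]add0r.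
by apply: add_spanB => //; apply: add_spanB => //; apply: add_span0.
Qed.

Lemma add_span_sum (I : finType) (x : I -> V) :
  (forall i, add_span X (x i)) -> add_span X (\sum_i x i).
Proof.
move=> Xx; elim/big_ind: _ => [|y z|i _]; last exact: Xx.
  exact: add_span0.
exact: add_spanD.
Qed.

Lemma add_span_min (L : V -> Prop) :
  L 0 -> (forall x y, L x -> L y -> L (x - y)) -> (forall x, X x -> L x) ->
  forall x, add_span X x -> L x.
Proof. by move=> L0 LB XL x; elim=> // *; apply: LB. Qed.

Lemma add_span_map (V' : zmodType) (Y : V' -> Prop) (g : V -> V') :
  zmod_morphism g -> (forall x, X x -> add_span Y (g x)) ->
  forall x, add_span X x -> add_span Y (g x).
Proof.
move=> gB XY; apply: add_span_min => // [|x y Yx Yy]; last first.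
  by rewrite gB; apply: add_spanB.
by have := gB 0 0; rewrite !subrr => ->; apply: add_span0.
Qed.

End AddSpan.

(** * Arrows, loops and Casimir relations in the preprojective algebra *)

Section PreprojectiveArrows.

Variables (R S : comPzRingType) (phi : {rmorphism R -> S}).
Variables (e f : 'I_4 -> S).

Local Notation P := (preproj phi e f).
Local Notation B := (preproj_base phi e f).
Local Notation scal := (preproj_scal phi e f).

Definition arrM (s : S) : P := preproj_proj phi e f (inM phi s).
Definition arrN (s : S) : P := preproj_proj phi e f (inN phi s).
Definition base_S (s : S) : P := B (0, s).

Lemma preproj_base_is_zmod_morphism : zmod_morphism B.
Proof. by move=> x y; rewrite /preproj_base !rmorphB. Qed.
HB.instance Definition _ := GRing.isZmodMorphism.Build (R * S)%type P B
  preproj_base_is_zmod_morphism.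

Lemma preproj_baseM x y : B (x * y) = B x * B y.
Proof. by rewrite /preproj_base !rmorphM. Qed.

Lemma preproj_base1 : B 1 = 1.
Proof. by rewrite /preproj_base !rmorph1. Qed.

Lemma base_S_is_zmod_morphism : zmod_morphism base_S.
Proof.
move=> x y; rewrite /base_S -raddfB; congr (B _).
by rewrite -[RHS]/(0 - 0, x - y) subrr.
Qed.
HB.instance Definition _ := GRing.isZmodMorphism.Build S P base_S
  base_S_is_zmod_morphism.

Lemma base_SM s t : base_S (s * t) = base_S s * base_S t.
Proof. by rewrite /base_S -preproj_baseM; congr (B (_, _)); rewrite mul0r. Qed.

Lemma arrM_is_zmod_morphism : zmod_morphism arrM.
Proof.
move=> x y; rewrite /arrM /inM -rmorphB -raddfB.
congr (preproj_proj _ _ _ (tvec _)).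
by rewrite -[RHS]/(x - y, 0 - 0) subrr.
Qed.
HB.instance Definition _ := GRing.isZmodMorphism.Build S P arrM
  arrM_is_zmod_morphism.

Lemma arrN_is_zmod_morphism : zmod_morphism arrN.
Proof.
move=> x y; rewrite /arrN /inN -rmorphB -raddfB.
congr (preproj_proj _ _ _ (tvec _)).
by rewrite -[RHS]/(0 - 0, x - y) subrr.
Qed.
HB.instance Definition _ := GRing.isZmodMorphism.Build S P arrN
  arrN_is_zmod_morphism.

Lemma base_arrM a s : B a * arrM s = arrM (phi a.1 * s).
Proof.
rewrite /preproj_base /arrM /inM -rmorphM -tvec_lact.
by congr (preproj_proj _ _ _ (tvec _)); rewrite /= /sum_lact /sum_ract /= mulr0.
Qed.

Lemma arrM_base a s : arrM s * B a = arrM (s * a.2).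
Proof.
rewrite /preproj_base /arrM /inM -rmorphM -tvec_ract.
by congr (preproj_proj _ _ _ (tvec _)); rewrite /= /sum_lact /sum_ract /= mul0r.
Qed.

Lemma base_arrN a s : B a * arrN s = arrN (a.2 * s).
Proof.
rewrite /preproj_base /arrN /inN -rmorphM -tvec_lact.
by congr (preproj_proj _ _ _ (tvec _)); rewrite /= /sum_lact /sum_ract /= mulr0.
Qed.

Lemma arrN_base a s : arrN s * B a = arrN (s * phi a.1).
Proof.
rewrite /preproj_base /arrN /inN -rmorphM -tvec_ract.
by congr (preproj_proj _ _ _ (tvec _)); rewrite /= /sum_lact /sum_ract /= mul0r.
Qed.

(** The idempotent [(0, 1)] fixes [M] on the right and kills it on the left. *)
Lemma arrMM s t : arrM s * arrM t = 0.
Proof.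
rewrite -[s]mulr1 -(arrM_base (0, 1)) -mulrA base_arrM /= rmorph0 mul0r raddf0.
by rewrite mulr0.
Qed.

Lemma arrNN s t : arrN s * arrN t = 0.
Proof.
rewrite -[t]mul1r -(base_arrN (0, 1)) mulrA arrN_base /= rmorph0 mulr0 raddf0.
by rewrite mul0r.
Qed.

Lemma arrM1N1 : arrM 1 * arrN 1 = 0.
Proof.
rewrite /arrM /arrN -rmorphM -[RHS](rmorph0 (preproj_proj phi e f)).
by apply/quot_projP; apply: ideal_gen_mem; left; apply: subr0.
Qed.

Lemma arrN_arrM_sum : \sum_i arrN (e i) * arrM (f i) = 0.
Proof.
rewrite /arrM /arrN; under eq_bigr => i _ do rewrite -rmorphM.
rewrite -rmorph_sum -[RHS](rmorph0 (preproj_proj phi e f)).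
by apply/quot_projP; apply: ideal_gen_mem; right; apply: subr0.
Qed.

Lemma arrM_base_S s t : arrM s * base_S t = arrM (s * t).
Proof. exact: arrM_base. Qed.

Lemma base_S_arrN s t : base_S s * arrN t = arrN (s * t).
Proof. exact: base_arrN. Qed.

Lemma arrME s : arrM s = arrM 1 * base_S s.
Proof. by rewrite arrM_base_S mul1r. Qed.

Lemma arrNE s : arrN s = base_S s * arrN 1.
Proof. by rewrite base_S_arrN mulr1. Qed.

Definition loop (s : S) : P := arrM s * arrN 1.

Lemma loop_is_zmod_morphism : zmod_morphism loop.
Proof. by move=> x y; rewrite /loop raddfB mulrBl. Qed.
HB.instance Definition _ := GRing.isZmodMorphism.Build S P loop
  loop_is_zmod_morphism.

Lemma loop1 : loop 1 = 0. Proof. exact: arrM1N1. Qed.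

Lemma loop_phi r s : loop (phi r * s) = B (r, 0) * loop s.
Proof. by rewrite /loop mulrA base_arrM. Qed.

(** Only the component of [a] in [R] acts on either side, and its image in [S] passes through the
    middle tensor sign over [S]. *)
Lemma base_loop a s : B a * loop s = loop s * B a.
Proof.
rewrite /loop mulrA base_arrM -mulrA arrN_base mul1r (arrNE (phi _)) mulrA.
by rewrite arrM_base_S mulrC.
Qed.

Lemma base_phi_arrN1 r : base_S (phi r) * arrN 1 = arrN 1 * B (r, 0).
Proof. by rewrite base_S_arrN arrN_base mulrC. Qed.

Lemma arrM1_base_phi r : arrM 1 * base_S (phi r) = B (r, 0) * arrM 1.
Proof. by rewrite base_arrM arrM_base_S mulrC. Qed.

(** The element written [e<q>f] in the overview; it instantiates [E] of the bimodule identity, with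
    [base_S] as [j]. *)
Definition hat (q : S) : P := arrN 1 * loop q * arrM 1.

Lemma hat_is_zmod_morphism : zmod_morphism hat.
Proof. by move=> x y; rewrite /hat raddfB mulrBr mulrBl. Qed.
HB.instance Definition _ := GRing.isZmodMorphism.Build S P hat
  hat_is_zmod_morphism.

Lemma hat_scall r q : hat (phi r * q) = base_S (phi r) * hat q.
Proof. by rewrite /hat loop_phi !mulrA base_phi_arrN1. Qed.

Lemma hat_scalr r q : hat (phi r * q) = hat q * base_S (phi r).
Proof. by rewrite /hat loop_phi base_loop -!mulrA arrM1_base_phi. Qed.

Lemma hat1 : hat 1 = 0.
Proof. by rewrite /hat loop1 mulr0 mul0r. Qed.

Lemma hat_unitl q : base_S 1 * hat q = hat q.
Proof. by rewrite /hat !mulrA base_S_arrN mulr1. Qed.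

Lemma hat_unitr q : hat q * base_S 1 = hat q.
Proof. by rewrite /hat -!mulrA arrM_base_S mulr1. Qed.

Lemma casimir_arrN_loop : \sum_i base_S (e i) * (arrN 1 * loop (f i)) = 0.
Proof.
under eq_bigr => i _ do rewrite /loop !mulrA -arrNE.
by rewrite -mulr_suml arrN_arrM_sum mul0r.
Qed.

Lemma casimir_hat_l : \sum_i base_S (e i) * hat (f i) = 0.
Proof.
under eq_bigr => i _ do rewrite /hat mulrA.
by rewrite -mulr_suml casimir_arrN_loop mul0r.
Qed.

(** * The symmetric Casimir relation and the central elements of degree 4 *)

Variable lambda : S -> R.
Hypotheses (lin : R_linear phi lambda) (dual : dual_bases phi lambda e f).

(* The Casimir element is symmetric because [lambda (x * y)] is. *)
Lemma arrN_arrM_sum_sym : \sum_i arrN (f i) * arrM (e i) = 0.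
Proof.
rewrite -[RHS]arrN_arrM_sum.
under eq_bigr => i _ do
  rewrite [f i](expand_e lin dual) raddf_sum mulr_suml /=.
rewrite exchange_big; apply: eq_bigr => k _.
rewrite [f k in RHS](expand_e lin dual) raddf_sum mulr_sumr /=.
apply: eq_bigr => i _; rewrite -(base_arrM (_, 0)) mulrA arrN_base mulrC.
by rewrite [f k * f i]mulrC [e k * _]mulrC.
Qed.

Lemma casimir_loop_arrM : \sum_i loop (f i) * arrM 1 * base_S (e i) = 0.
Proof.
under eq_bigr => i _ do
  rewrite /loop arrME -!mulrA -arrME [base_S _ * _]mulrA -arrNE.
by rewrite -mulr_sumr arrN_arrM_sum_sym mulr0.
Qed.

Lemma casimir_hat_r : \sum_i hat (f i) * base_S (e i) = 0.
Proof.
under eq_bigr => i _ do rewrite /hat -mulrA -mulrA [loop _ * _]mulrA.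
by rewrite -mulr_sumr casimir_loop_arrM mulr0.
Qed.

(** The element [q(s)] of the overview, whose expanded form is [loop_squareE]. *)
Definition loop_square (s : S) : P := square_elt phi lambda e f base_S hat s.

Definition central4 (s : S) : P := loop s * loop s + loop_square s.

Lemma loop_square_comm s u :
  base_S u * loop_square s = loop_square s * base_S u.
Proof.
apply: (square_elt_comm lin dual base_SM hat_scall hat_scalr hat1) => //.
- exact: casimir_hat_l.
- exact: casimir_hat_r.
- exact: hat_unitl.
- exact: hat_unitr.
Qed.

Lemma loop_square_unitl s : base_S 1 * loop_square s = loop_square s.
Proof. apply: square_elt_unitl; [exact: base_SM | exact: hat_unitl]. Qed.

Lemma loop_square_unitr s : loop_square s * base_S 1 = loop_square s.
Proof. apply: square_elt_unitr; [exact: base_SM | exact: hat_unitr]. Qed.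

Lemma loop_squareE s : loop_square s =
  hat (s * s - phi (trace lambda e f s) * s)
  + base_S s * hat s + hat s * base_S s.
Proof.
rewrite /loop_square /square_elt /cotrace [hat (_ - _)]raddfB /= hat_scall.
by rewrite !opprD !opprK !addrA.
Qed.

(** [loop_square s] lies in the corner of the idempotent [(0, 1)], which annihilates [(r, 0)]. *)
Lemma base_R_square r s : B (r, 0) * loop_square s = 0.
Proof.
rewrite -loop_square_unitl mulrA -preproj_baseM.
rewrite (_ : (r, 0) * (0, 1) = 0); last by congr (_, _); rewrite ?mulr0 ?mul0r.
by rewrite raddf0 mul0r.
Qed.

Lemma square_base_R r s : loop_square s * B (r, 0) = 0.
Proof.
rewrite -loop_square_unitr -mulrA -preproj_baseM.
rewrite (_ : (0, 1) * (r, 0) = 0); last by congr (_, _); rewrite ?mulr0 ?mul0r.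
by rewrite raddf0 mulr0.
Qed.

Lemma arrN1_square s : arrN 1 * loop_square s = 0.
Proof.
rewrite -{1}[1]mulr1 -(rmorph1 phi) -(arrN_base (1, 0)).
by rewrite -mulrA base_R_square mulr0.
Qed.

Lemma square_arrM1 s : loop_square s * arrM 1 = 0.
Proof.
rewrite -{1}[1]mulr1 -{1}(rmorph1 phi) -(base_arrM (1, 0)).
by rewrite mulrA square_base_R mul0r.
Qed.

Lemma loop_loop_square t s : loop t * loop_square s = 0.
Proof. by rewrite /loop -(mulrA (arrM t)) arrN1_square mulr0. Qed.

Lemma loop_square_loop s t : loop_square s * loop t = 0.
Proof.
by rewrite /loop arrME -(mulrA (arrM 1)) (mulrA _ (arrM 1)) square_arrM1 mul0r.
Qed.

Lemma hat_arrN1 q : hat q * arrN 1 = 0.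
Proof. by rewrite /hat -mulrA arrM1N1 mulr0. Qed.

Lemma arrM1_hat q : arrM 1 * hat q = 0.
Proof. by rewrite /hat !mulrA arrM1N1 !mul0r. Qed.

(** Of the three terms of [loop_squareE], those ending in [hat] vanish against [arrN 1] because
    [arrM 1 * arrN 1 = 0]; in the last term, [s] between the two arrows closes a second loop. *)
Lemma square_arrN1 s : loop_square s * arrN 1 = arrN 1 * loop s * loop s.
Proof.
rewrite loop_squareE !mulrDl hat_arrN1 -(mulrA (base_S s)) hat_arrN1 mulr0.
rewrite !add0r -(mulrA (hat s)) -arrNE /hat /loop (arrNE s) -!mulrA.
by rewrite [arrM 1 * (_ * _)]mulrA -arrME.
Qed.

Lemma arrM1_square s : arrM 1 * loop_square s = loop s * loop s * arrM 1.
Proof.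
rewrite loop_squareE !mulrDr arrM1_hat (mulrA _ (hat s)) arrM1_hat mul0r.
by rewrite add0r addr0 mulrA -arrME /hat /loop !mulrA.
Qed.

Lemma central4_arrN1 s : central4 s * arrN 1 = arrN 1 * loop s * loop s.
Proof.
by rewrite mulrDl square_arrN1 /loop -!mulrA arrNN !mulr0 add0r.
Qed.

Lemma arrN1_central4 s : arrN 1 * central4 s = arrN 1 * loop s * loop s.
Proof. by rewrite mulrDr arrN1_square addr0 mulrA. Qed.

Lemma central4_arrM1 s : central4 s * arrM 1 = loop s * loop s * arrM 1.
Proof. by rewrite mulrDl square_arrM1 addr0. Qed.

Lemma arrM1_central4 s : arrM 1 * central4 s = loop s * loop s * arrM 1.
Proof.
by rewrite mulrDr arrM1_square /loop !mulrA arrMM !mul0r add0r.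
Qed.

(** On the square of the loop this is [base_loop]. On [loop_square s] the idempotent [(0, 1)]
    reduces [a] to its component in [S], where [loop_square_comm] applies. *)
Lemma base_central4 a s : B a * central4 s = central4 s * B a.
Proof.
rewrite mulrDl mulrDr mulrA base_loop -mulrA base_loop mulrA; congr (_ + _).
rewrite -{1}loop_square_unitl -{2}loop_square_unitr mulrA -[RHS]mulrA.
rewrite -!preproj_baseM.
rewrite (_ : a * (0, 1) = (0, a.2)); last first.
  by congr (_, _); rewrite ?mulr0 ?mulr1.
rewrite (_ : (0, 1) * a = (0, a.2)); last first.
  by congr (_, _); rewrite ?mul0r ?mul1r.
exact: loop_square_comm.
Qed.

Lemma preproj_proj_vec m n :
  preproj_proj phi e f (tvec (B := bimod_sum (bimodM phi) (bimodN phi)) (m, n))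
  = arrM m + arrN n.
Proof.
rewrite /arrM /arrN /inM /inN -rmorphD -raddfD.
congr (preproj_proj _ _ _ (tvec _)).
by rewrite -[RHS]/(m + 0, 0 + n) addr0 add0r.
Qed.

Lemma preproj_ind (Q : P -> Prop) :
  (forall a, Q (B a)) -> (forall m, Q (arrM m)) -> (forall n, Q (arrN n)) ->
  (forall x, Q x -> Q (- x)) -> (forall x y, Q x -> Q y -> Q (x + y)) ->
  (forall x y, Q x -> Q y -> Q (x * y)) -> forall x, Q x.
Proof.
move=> Qb QM QN Qopp QD Qmul x; have [t <-] := quot_proj_surj x.
elim/tensor_alg_ind: t => [a|[m n]|t|t u|t u].
- exact: Qb.
- have : Q (arrM m + arrN n) by apply: QD.
  by rewrite -preproj_proj_vec.
- by rewrite rmorphN; apply: Qopp.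
- by rewrite rmorphD; apply: QD.
- by rewrite rmorphM; apply: Qmul.
Qed.

Lemma central4_central s : is_central (central4 s).
Proof.
elim/preproj_ind => [a|m|n|x|x y|x y].
- by rewrite base_central4.
- rewrite arrME mulrA central4_arrM1 -arrM1_central4 -!mulrA; congr (_ * _).
  by rewrite base_central4.
- by rewrite arrNE -!mulrA arrN1_central4 -central4_arrN1 !mulrA base_central4.
- by rewrite mulrN mulNr => ->.
- move=> cx cy.
  by rewrite (mulrDr (central4 s)) (mulrDl _ _ (central4 s)) cx cy.
- by rewrite mulrA => -> cy; rewrite -mulrA cy mulrA.
Qed.

Lemma central4_Z4 s : Z4 (central4 s).
Proof.
split; first exact: central4_central.
pose q := s * s - phi (trace lambda e f s) * s.
(* One row for each summand of [central4 s]: the squared loop, [hat q], [s] times [hat s], and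
   [hat s] times [s]. A pair lists the components in [M] and [N]. *)
pose v := [:: [:: (s, 0); (0, 1); (s, 0); (0, 1)];
              [:: (0, 1); (q, 0); (0, 1); (1, 0)];
              [:: (0, s); (s, 0); (0, 1); (1, 0)];
              [:: (0, 1); (s, 0); (0, 1); (s, 0)]] : seq (seq (S * S)).
pose t : TRS phi := \sum_(i < 4) tscal _ 1 * \prod_(k < 4)
  tvec (B := bimod_sum (bimodM phi) (bimodN phi)) (nth 0 (nth [::] v i) k).
exists t; split.
  by exists 4%N, (fun=> 1), (fun i k => nth 0 (nth [::] v i) k).
rewrite /t sum4E !rmorph1 !mul1r !big_ord_recl !big_ord0 !mulr1 /=.
rewrite !rmorphD !rmorphM -!/(inM phi _) -!/(inN phi _) -!/(arrM _) -!/(arrN _).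
rewrite /central4 loop_squareE -/q -!addrA.
congr (_ + (_ + (_ + _))); rewrite /hat /loop ?(arrNE s) -?mulrA //.
by rewrite -arrME !mulrA.
Qed.

End PreprojectiveArrows.

(** * Products of arrows and their reduction modulo [Z4] *)

Section Monomials.

Variables (R S : comPzRingType) (phi : {rmorphism R -> S}).
Variables (lambda : S -> R) (e f : 'I_4 -> S).
Hypotheses (lin : R_linear phi lambda) (dual : dual_bases phi lambda e f).

Local Notation P := (preproj phi e f).
Local Notation B := (preproj_base phi e f).
Local Notation base_S := (base_S phi e f).
Local Notation arrM := (arrM phi e f).
Local Notation arrN := (arrN phi e f).
Local Notation loop := (loop phi e f).

Definition arrow (c : bool) : P := if c then arrN 1 else arrM 1.

Inductive mono : nat -> P -> Prop :=
| mono_base a : mono 0 (B a)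
| mono_step n x c a : mono n x -> mono n.+1 (x * arrow c * B a).

Lemma base_mono n x a : mono n x -> mono n (B a * x).
Proof.
elim=> [a'|m y c a' _ IH]; first by rewrite -preproj_baseM; apply: mono_base.
by rewrite !mulrA; apply: mono_step.
Qed.

Lemma mono_mul m n x y : mono m x -> mono n y -> mono (m + n) (x * y).
Proof.
move=> xm; elim=> [a|k z c a _ IH]; last first.
  by rewrite addnS !mulrA; apply: mono_step.
rewrite addn0; elim: xm => [a'|k z c a' zk _].
  by rewrite -preproj_baseM; apply: mono_base.
by rewrite -mulrA -preproj_baseM; apply: mono_step.
Qed.

Lemma mono_base_S s : mono 0 (base_S s). Proof. exact: mono_base. Qed.

Lemma mono_arrow c : mono 1 (arrow c).
Proof.
rewrite -[arrow c]mul1r -[X in mono _ X]mulr1 -preproj_base1.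
exact/mono_step/mono_base.
Qed.

Lemma mono_arrM s : mono 1 (arrM s).
Proof. by rewrite arrME; exact: (mono_mul (mono_arrow false) (mono_base _)). Qed.

Lemma mono_arrN s : mono 1 (arrN s).
Proof. by rewrite arrNE; exact: (mono_mul (mono_base _) (mono_arrow true)). Qed.

Lemma mono_loop s : mono 2 (loop s).
Proof. exact: (mono_mul (mono_arrM s) (mono_arrN 1)). Qed.

Definition graded (x : P) : Prop := exists n, mono n x.

Lemma graded_span x : add_span graded x.
Proof.
elim/preproj_ind: x => [a|m|n|x Xx|x y|x y Xx Xy].
- by apply: add_span_mem; exists 0%N; apply: mono_base.
- by apply: add_span_mem; exists 1%N; apply: mono_arrM.
- by apply: add_span_mem; exists 1%N; apply: mono_arrN.
- by rewrite -sub0r; apply: add_spanB => //; apply: add_span0.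
- exact: add_spanD.
- apply: (add_span_map (g := fun x => x * y)) Xx => [u v|u [m um]].
    exact: mulrBl.
  apply: (add_span_map (g := fun y => u * y)) Xy => [v w|v [n vn]].
    exact: mulrBr.
  by apply: add_span_mem; exists (m + n)%N; apply: mono_mul.
Qed.

(** The flag is the type of the last arrow. Without arrows either flag is allowed, so that any arrow
    may come first. *)
Inductive alt_mono : bool -> nat -> P -> Prop :=
| alt_base c a : alt_mono c 0 (B a)
| alt_step c n x a :
    alt_mono c n x -> alt_mono (~~ c) n.+1 (x * arrow (~~ c) * B a).

(** Zero has to count as alternating at every length, since [mono_alt] also meets products that
    vanish. *)
Lemma alt_mono0 c n : alt_mono c n 0.
Proof.
have B0 : 0 = B 0 by rewrite raddf0.
elim: n c => [|n IH] c.
  by rewrite [X in alt_mono _ _ X]B0; apply: alt_base.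
have -> : 0 = 0 * arrow c * B 0 by rewrite !mul0r.
by rewrite -[c]negbK; apply/alt_step/IH.
Qed.

Lemma alt_mono_inv c n x : alt_mono c n.+1 x ->
  exists y a, alt_mono (~~ c) n y /\ x = y * arrow c * B a.
Proof.
move Em : n.+1 => m alt_x; case: alt_x Em => // {}c k y a alt_y [Ek].
by rewrite Ek negbK; exists y, a.
Qed.

Lemma alt_mono0_inv c x : alt_mono c 0 x -> exists a, x = B a.
Proof.
suff inv n : alt_mono c n x -> n = 0%N -> exists a, x = B a by move/inv; apply.
by case=> // _ a; exists a.
Qed.

Lemma arrow_base_arrow c a : arrow c * B a * arrow c = 0.
Proof.
by case: c; rewrite /arrow ?(arrN_base, arrM_base) (arrNN, arrMM).
Qed.

(** Two consecutive equal arrows multiply to zero, even with a base element between them. *)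
Lemma mono_alt n x : mono n x -> exists c, alt_mono c n x.
Proof.
elim=> [a|m y c a _ [c' alt_y]]; first by exists true; apply: alt_base.
have [->|] := eqVneq c (~~ c'); first by exists (~~ c'); apply: alt_step.
move=> c_neq; have {c_neq}-> : c = c' by case: c c' c_neq {alt_y} => [] [].
(* With no earlier arrow the clash is only one of flags, and the flag can be changed. *)
case: m alt_y => [|m].
  case/alt_mono0_inv => a' ->; exists c'.
  by rewrite -[c']negbK; apply/alt_step/alt_base.
case/alt_mono_inv => z [a' [_ ->]]; exists c.
rewrite -(mulrA z) -(mulrA z) arrow_base_arrow mulr0 mul0r.
exact: alt_mono0.
Qed.

(** Here [n] counts only the arrows beside the central factor, which accounts for four more. *)
Definition Z4span (n : nat) : P -> Prop :=
  add_span (fun x => exists z y, [/\ Z4 z, mono n y & x = z * y]).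

Lemma base_Z4span n a x : Z4span n x -> Z4span n (B a * x).
Proof.
apply: (add_span_map (g := fun x => B a * x)) => [y z|_ [z [y [Zz yn ->]]]].
  exact: mulrBr.
apply: add_span_mem; exists z, (B a * y); split=> //; first exact: base_mono.
by rewrite !mulrA; case: Zz => ->.
Qed.

Lemma Z4span_mono m n x y : Z4span m x -> mono n y -> Z4span (m + n) (x * y).
Proof.
move=> xm yn.
apply: (add_span_map (g := fun x => x * y)) xm => [u v|_ [z [w [Zz wm ->]]]].
  exact: mulrBl.
rewrite -mulrA; apply: add_span_mem; exists z, (w * y).
by split=> //; apply: mono_mul.
Qed.

Let central_Z4 s := central4_Z4 lin dual s.

Lemma Z4span_mem n s y : mono n y -> Z4span n (central4 phi e f lambda s * y).
Proof.
move=> yn; apply: add_span_mem; exists (central4 phi e f lambda s), y.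
by split=> //; apply: central_Z4.
Qed.

(** An instance of [alternating_mem] for left multiplication by [S]. Next to [arrN 1], or after
    another loop, a squared loop can be replaced by a [central4]; the Casimir hypothesis is
    [casimir_arrN_loop]. *)
Lemma Z4span_arrN1_loop3 a b c : Z4span 3 (arrN 1 * loop a * loop b * loop c).
Proof.
have central s x :
    central4 phi e f lambda s * x = x * central4 phi e f lambda s.
  by case: (central_Z4 s) => ->.
apply: (@alternating_mem _ _ _ _ _ _ lin dual P (fun s x => base_S s * x)
  (Z4span 3) _ _ _ _ _ _ (fun a b c => arrN 1 * loop a * loop b * loop c)).
- by move=> *; rewrite raddfD mulrDl.
- by move=> *; rewrite mulrDr.
- by move=> *; rewrite base_SM mulrA.
- exact: add_span0.
- exact: add_spanB.
- by move=> s x; apply: base_Z4span.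
- by move=> *; rewrite raddfD !(mulrDr, mulrDl).
- by move=> *; rewrite raddfD !(mulrDr, mulrDl).
- by move=> *; rewrite raddfD !(mulrDr, mulrDl).
- move=> r x y z; rewrite loop_phi; move: (loop x) (loop y) (loop z) => u v w.
  by rewrite !mulrA base_phi_arrN1.
- move=> r x y z; rewrite loop_phi; have := base_loop phi e f (r, 0) x.
  move: (loop x) (loop y) (loop z) => u v w Bu.
  by rewrite !mulrA base_phi_arrN1 -(mulrA _ u) -Bu !mulrA.
- move=> r x y z; rewrite loop_phi.
  have := base_loop phi e f (r, 0) x; have := base_loop phi e f (r, 0) y.
  move: (loop x) (loop y) (loop z) => u v w Bv Bu.
  rewrite !mulrA base_phi_arrN1 -(mulrA _ v) -Bv !mulrA.
  by rewrite -(mulrA _ u) -Bu !mulrA.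
- by move=> *; rewrite loop1 mulr0 !mul0r.
- by move=> *; rewrite !mulrA base_S_arrN mulr1.
- move=> x y; rewrite -(central4_arrN1 _ _ _ lambda) -mulrA; apply: Z4span_mem.
  exact: (mono_mul (mono_arrow true) (mono_loop y)).
- move=> x y.
  have -> : arrN 1 * loop x * loop y * loop y
      = central4 phi e f lambda y * (arrN 1 * loop x).
    rewrite central mulrDr -(mulrA (arrN 1) (loop x) (loop_square _ _ _ _ _)).
    by rewrite loop_loop_square mulr0 addr0 mulrA.
  exact/Z4span_mem/(mono_mul (mono_arrow true) (mono_loop x)).
- move=> x y; under eq_bigr => i _ do
    rewrite (mulrA (base_S _) _ (loop y)) (mulrA (base_S _) _ (loop x)).
  by rewrite -!mulr_suml casimir_arrN_loop !mul0r.
Qed.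

(** The mirror image, with right multiplication, which is an action because [S] is commutative. The
    arguments are reversed so that the first one is adjacent to [arrM 1], as [casimir_loop_arrM]
    requires. *)
Lemma Z4span_loop3_arrM1 a b c : Z4span 3 (loop c * loop b * loop a * arrM 1).
Proof.
have central s x :
    central4 phi e f lambda s * x = x * central4 phi e f lambda s.
  by case: (central_Z4 s) => ->.
apply: (@alternating_mem _ _ _ _ _ _ lin dual P (fun s x => x * base_S s)
  (Z4span 3) _ _ _ _ _ _ (fun a b c => loop c * loop b * loop a * arrM 1)).
- by move=> *; rewrite raddfD mulrDr.
- by move=> *; rewrite mulrDl.
- by move=> *; rewrite mulrC base_SM mulrA.
- exact: add_span0.
- exact: add_spanB.
- by move=> s x xK; apply: (Z4span_mono xK (mono_base_S s)).
- by move=> *; rewrite raddfD !(mulrDr, mulrDl).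
- by move=> *; rewrite raddfD !(mulrDr, mulrDl).
- by move=> *; rewrite raddfD !(mulrDr, mulrDl).
- move=> r x y z; rewrite loop_phi base_loop.
  move: (loop x) (loop y) (loop z) => u v w.
  rewrite -[RHS]mulrA -[w * v * (u * _) * _]mulrA -[u * _ * _]mulrA.
  by rewrite arrM1_base_phi !mulrA.
- move=> r x y z; rewrite loop_phi base_loop.
  have := base_loop phi e f (r, 0) x.
  move: (loop x) (loop y) (loop z) => u v w Bu.
  by rewrite -[RHS]mulrA arrM1_base_phi !mulrA -(mulrA _ _ u) Bu !mulrA.
- move=> r x y z; rewrite loop_phi base_loop.
  have := base_loop phi e f (r, 0) x; have := base_loop phi e f (r, 0) y.
  move: (loop x) (loop y) (loop z) => u v w Bv Bu.
  rewrite -[RHS]mulrA arrM1_base_phi !mulrA -(mulrA w _ v) Bv !mulrA.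
  by rewrite -(mulrA _ _ u) Bu !mulrA.
- by move=> *; rewrite loop1 mulr0 !mul0r.
- by move=> *; rewrite -mulrA arrM_base_S mulr1.
- move=> x y.
  have -> : loop y * loop x * loop x * arrM 1
      = central4 phi e f lambda x * (loop y * arrM 1).
    by rewrite central -(mulrA (loop y) (arrM 1)) arrM1_central4 !mulrA.
  exact/Z4span_mem/(mono_mul (mono_loop y) (mono_arrow false)).
- move=> x y.
  have -> : loop y * loop y * loop x * arrM 1
      = central4 phi e f lambda y * (loop x * arrM 1).
    by rewrite mulrDl (mulrA _ (loop x)) (mulrA _ (loop x)) loop_square_loop
               mul0r addr0.
  exact/Z4span_mem/(mono_mul (mono_loop x) (mono_arrow false)).
- move=> x y; under eq_bigr => i _ do
    rewrite -(mulrA _ (loop (f i)) (arrM 1)) -(mulrA (loop y * loop x)).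
  by rewrite -mulr_sumr (casimir_loop_arrM lin dual) mulr0.
Qed.

Lemma arrM_base_arrN a : arrow false * B a * arrow true = loop a.2.
Proof. by rewrite /arrow arrM_base mul1r. Qed.

(** Seven alternating arrows begin and end with the same type. As base elements commute with loops,
    they collect into [arrN 1] followed by three loops, or three loops followed by [arrM 1], between
    two base elements. *)
Lemma mono7 x : mono 7 x -> Z4span 3 x.
Proof.
have merge y a : y * arrow false * B a * arrow true = y * loop a.2.
  by rewrite -!(mulrA y) arrM_base_arrN.
have comm y a s : y * B a * loop s = y * loop s * B a.
  by rewrite -(mulrA y) base_loop (mulrA y (loop s)).
have baseB y a a' : y * B a * B a' = y * B (a * a').
  by rewrite preproj_baseM mulrA.
case/mono_alt => c.
case/alt_mono_inv => y1 [a1 [+ ->]]; case/alt_mono_inv => y2 [a2 [+ ->]].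
case/alt_mono_inv => y3 [a3 [+ ->]]; case/alt_mono_inv => y4 [a4 [+ ->]].
case/alt_mono_inv => y5 [a5 [+ ->]]; case/alt_mono_inv => y6 [a6 [+ ->]].
case/alt_mono_inv => y7 [a7 [+ ->]].
case/alt_mono0_inv => a0 -> {y1 y2 y3 y4 y5 y6 y7 x}.
case: c; rewrite /= !merge.
- rewrite !comm !baseB -!(mulrA (B a0)).
  exact/base_Z4span/(Z4span_mono (Z4span_arrN1_loop3 _ _ _) (mono_base _)).
- rewrite -!comm -!preproj_baseM -!(mulrA (B _)).
  exact/base_Z4span/(Z4span_mono (Z4span_loop3_arrM1 _ _ _) (mono_base _)).
Qed.

Lemma mono_ge7 n x : mono (n + 7) x -> Z4span (n + 3) x.
Proof.
elim: n x => [|n IH] x; first exact: mono7.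
rewrite addSn; move Em : (n + 7).+1 => m mono_x.
case: mono_x Em => // k y c a yk [Ek].
rewrite addSn -addn1 -mulrA; apply: Z4span_mono; first by apply: IH; rewrite Ek.
exact: (mono_mul (mono_arrow c) (mono_base a)).
Qed.

End Monomials.

(** * From products of arrows to words of [H], and the image of [sigma] *)

Section Words.

Variables (R S : comPzRingType) (phi : {rmorphism R -> S}).
Variables (b : 'I_4 -> S) (e f : 'I_4 -> S).
Hypothesis basis_b : is_basis phi b.

Local Notation P := (preproj phi e f).
Local Notation B := (preproj_base phi e f).
Local Notation scal := (preproj_scal phi e f).
Local Notation chi := (chi phi e f b).
Local Notation arrow := (arrow phi e f).

Lemma preproj_scalM r s : scal (r * s) = scal r * scal s.
Proof. by rewrite /preproj_scal -preproj_baseM rmorphM. Qed.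

Lemma preproj_scal_central r (p : P) : scal r * p = p * scal r.
Proof.
rewrite /preproj_scal; elim/preproj_ind: p => [a|m|n|x|x y|x y].
- by rewrite -!preproj_baseM; congr (B (_, _)); apply: mulrC.
- by rewrite base_arrM arrM_base mulrC.
- by rewrite base_arrN arrN_base mulrC.
- by rewrite mulrN mulNr => ->.
- by rewrite mulrDr mulrDl => -> ->.
- by rewrite mulrA => -> cy; rewrite -mulrA cy mulrA.
Qed.

Lemma chi_cat u v : chi (u ++ v) = chi u * chi v.
Proof. exact: big_cat. Qed.

Definition arrow_letter (c : bool) : letter := if c then Le else Lf.

Lemma chi_arrow c : chi [:: arrow_letter c] = arrow c.
Proof. by rewrite /chi big_seq1; case: c. Qed.

(* The sequence [[::]] is treated as ending with a basis letter. *)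
Definition alt_word (c : bool) (n : nat) (u : seq letter) : bool :=
  [&& sorted may_follow u, count is_arrow u == n
    & may_follow (last (Lbasis i0) u) (arrow_letter (~~ c))].

Lemma base_words a : add_span (fun y => exists r v,
  [/\ sorted may_follow v, ~~ has is_arrow v & y = scal r * chi v]) (B a).
Proof.
(* Write [(r, s)] as the scalar [r] plus [(0, s - phi r)], and expand the latter in the basis [b];
   the scalar uses the empty word. *)
have [c [Dc _]] := basis_b (a.2 - phi a.1).
have -> : B a = scal a.1 * chi [::] + \sum_i scal (c i) * chi [:: Lbasis i].
  have -> : B a = scal a.1 + base_S phi e f (a.2 - phi a.1).
    rewrite /preproj_scal /base_S -raddfD; congr (B _); case: a {Dc} => r s /=.
    by rewrite -[RHS]/(r + 0, phi r + (s - phi r)) addr0 addrC subrK.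
  rewrite Dc raddf_sum /=.
  rewrite /chi big_nil mulr1; congr (_ + _); apply: eq_bigr => i _.
  rewrite big_seq1 /= /preproj_scal -preproj_baseM /base_S.
  by congr (B _); rewrite -[RHS]/(_ * 0, _) mulr0.
apply: add_spanD.
  by apply: add_span_mem; exists a.1, [::].
by apply: add_span_sum => i; apply: add_span_mem; exists (c i), [:: Lbasis i].
Qed.

(** By [base_words] each base element contributes at most one basis letter, and the arrows already
    alternate, so no forbidden adjacency arises. *)
Lemma alt_mono_words c n (x : P) : alt_mono c n x ->
  add_span (fun y => exists r u, alt_word c n u /\ y = scal r * chi u) x.
Proof.
elim=> {c n x} [c a|c n x a _ IH].
  apply: (add_span_map (g := id)) (base_words a) => // _ [r [v [sv nv ->]]].
  apply: add_span_mem; exists r, v; split=> //; rewrite /alt_word sv.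
  rewrite has_count -leqNgt leqn0 in nv; rewrite nv /=.
  case/lastP: v nv {sv} => [|v l]; first by case: c.
  by rewrite last_rcons -cats1 count_cat /= addnC; case: c; case: l.
apply: (add_span_map (g := fun x => x * arrow (~~ c) * B a)) IH => [y z|].
  by rewrite !mulrBl.
move=> _ [r [u [/and3P[su /eqP nu lu] ->]]].
apply: (add_span_map (g := fun y => scal r * chi u * arrow (~~ c) * y))
         (base_words a).
  by move=> y z; rewrite mulrBr.
move=> _ [r' [v [sv nv ->]]]; apply: add_span_mem.
exists (r * r'), (u ++ arrow_letter (~~ c) :: v); split; last first.
  rewrite -cat1s !chi_cat chi_arrow preproj_scalM -!mulrA; congr (_ * _).
  rewrite (mulrA (chi u)) (mulrA (chi u * _) (scal r')) -preproj_scal_central.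
  by rewrite -!mulrA.
(* A sorted word without arrows has at most one letter, as basis letters may not be adjacent. *)
have [{nv sv}->|[i {nv sv}->]] : v = [::] \/ exists i, v = [:: Lbasis i].
  by case: v sv nv => [|[i||] [|[k||] v]] //=; [left | right; exists i].
- rewrite /alt_word last_cat /= count_cat /= addn0 nu negbK.
  have -> : is_arrow (arrow_letter (~~ c)) by case: c lu.
  have -> : may_follow (arrow_letter (~~ c)) (arrow_letter c) by case: c lu.
  rewrite addn1 eqxx andbT; case: u su lu {nu} => [|l u] //= su lu.
  by rewrite cat_path su /= lu.
- rewrite /alt_word last_cat /= count_cat /= addn0 nu.
  have -> : is_arrow (arrow_letter (~~ c)) by case: c lu.
  rewrite addn1 eqxx /=; case: u su lu {nu} => [|l u] /= su lu.
    by case: c lu.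
  by rewrite cat_path su /= lu; case: c lu.
Qed.


Variable a : seq (seq letter).
Hypothesis a_H : enumerates_H a.

Definition sigma_image (p : P) : Prop :=
  exists z : 'I_(size a) -> RZ4 phi e f, sigma b z = p.

Lemma sigma_imageD p q : sigma_image p -> sigma_image q -> sigma_image (p + q).
Proof.
move=> [z <-] [w <-].
exists (fun i => exist _ _ (subalg_add (svalP (z i)) (svalP (w i)))).
by rewrite /sigma -big_split; apply: eq_bigr => i _; rewrite mulrDl.
Qed.

Lemma sigma_imageM z p :
  subalg_gen (@Z4 _ _ _ _ _ _) z -> sigma_image p -> sigma_image (z * p).
Proof.
move=> Zz [w <-]; exists (fun i => exist _ _ (subalg_mul Zz (svalP (w i)))).
by rewrite /sigma mulr_sumr; apply: eq_bigr => i _; rewrite mulrA.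
Qed.

Lemma scal0 : scal 0 = 0.
Proof. by rewrite /preproj_scal rmorph0 raddf0. Qed.

Lemma scal1 : scal 1 = 1.
Proof. by rewrite /preproj_scal rmorph1 -preproj_base1. Qed.

Lemma sigma_image0 : sigma_image 0.
Proof.
exists (fun=> exist _ _ (subalg_scal _ 0)).
by rewrite /sigma big1 // => i _; rewrite /= scal0 mul0r.
Qed.

Lemma sigma_imageB p q : sigma_image p -> sigma_image q -> sigma_image (p - q).
Proof.
move=> Lp Lq; apply: sigma_imageD => //.
have scalN1 : scal (-1) = -1.
  by rewrite -scal1 /preproj_scal -raddfN; congr (B (_, _)); rewrite rmorphN.
rewrite -mulN1r -scalN1.
by apply: sigma_imageM => //; apply: subalg_scal.
Qed.

Lemma sigma_image_chi u : word_in_H u -> sigma_image (chi u).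
Proof.
have [uniq_a mem_a] := a_H; rewrite -mem_a => u_a.
pose k := Ordinal (etrans (index_mem u a) u_a).
exists (fun i => exist _ _ (subalg_scal _ (i == k)%:R)).
rewrite /sigma (bigD1 k) //= eqxx scal1 mul1r nth_index // big1 ?addr0 // => i.
by move=> /negPf->; rewrite scal0 mul0r.
Qed.

End Words.

Theorem theorem5p2 (R S : comPzRingType) (phi : {rmorphism R -> S})
    (b : 'I_4 -> S) (lambda : S -> R) (e f : 'I_4 -> S)
    (a : seq (seq letter)) :
  noetherian R ->
  relative_frobenius phi 4 ->
  is_basis phi b ->
  hom_generator phi lambda ->
  dual_bases phi lambda e f ->
  enumerates_H a ->
  forall p : preproj phi e f,
    exists z : 'I_(size a) -> RZ4 phi e f, sigma b z = p.
Proof.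
move=> _ _ basis_b [lin _] dual a_H p.
have imB := @sigma_imageB _ _ phi b e f a.
have im0 := sigma_image0 phi b e f a.
suff mono_im n (x : preproj phi e f) : mono n x -> sigma_image b a x.
  by apply: (add_span_min im0 imB) (graded_span p) => x [n]; apply: mono_im.
(* Up to six arrows, the product expands directly into words of [H]. *)
elim/ltn_ind: n x => n IH x mono_x; have [n_le6|n_gt6] := leqP n 6.
  have [c /(alt_mono_words basis_b)] := mono_alt mono_x.
  apply: (add_span_min im0 imB) => _ [r [u [/and3P[su /eqP nu _] ->]]].
  apply: sigma_imageM; first exact: subalg_scal.
  by apply: sigma_image_chi => //; rewrite /word_in_H nu n_le6.
(* From seven arrows on, [n = (n - 7) + 7] is traded for [(n - 7) + 3], which is smaller. *)
rewrite -(subnK n_gt6) in mono_x.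
apply: (add_span_min im0 imB) (mono_ge7 lin dual mono_x).
move=> _ [z [y [Zz my ->]]].
apply: sigma_imageM; first exact: subalg_mem.
apply: IH my; lia.
Qed.
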